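(* Let $0<\beta<\alpha<1$ be constants independent of $n$, and let $m=\alpha n$, $k=\beta n$. Let $A$ be an $m\times n$ matrix with i.i.d. standard normal components, and let $\xi_{uric}=\max_{\mathbf{x}\in S_{ric}}\|A\mathbf{x}\|_2$. For $c>0$ let $$\widehat{\gamma}(c)=\frac{2c+\sqrt{4c^2+16\alpha}}{8},\qquad I_{sph}(c,\alpha)=\widehat{\gamma}(c)-\frac{\alpha}{2c}\log\left(1-\frac{c}{2\widehat{\gamma}(c)}\right).$$ For $c>0$, $\gamma$ with $\frac{c}{4\gamma}<\frac12$ (i.e. $\gamma>c/2$) and $\nu\geq 0$ let $$p=\frac{c}{4\gamma},\quad r=-c\nu,\quad C=\frac{e^{r}}{\sqrt{1-2p}},\quad a=2\sqrt{\nu\gamma}\sqrt{1-2p},$$ $$I^{(uric)}(c,\gamma,\nu)=C\,\mathrm{erfc}\left(\frac{a}{\sqrt2}\right)+\left(1-\mathrm{erfc}\left(\sqrt{2\nu\gamma}\right)\right),$$ and $$I_{uric}(c,\beta)=\inf_{\gamma>c/2,\ \nu\geq 0}\left(\nu\beta+\gamma+\frac{1}{c}\log I^{(uric)}(c,\gamma,\nu)\right).$$ Then $$\limsup_{n\rightarrow\infty}\frac{E\,\xi_{uric}}{\sqrt{m}}\leq\frac{1}{\sqrt{\alpha}}\inf_{c>0}\left(-\frac{c}{2}+I_{uric}(c,\beta)+I_{sph}(c,\alpha)\right).$$ Moreover, let $\xi_{uric}^{(u,low)}$ be a constant such that $$\frac{1}{\sqrt{\alpha}}\inf_{c>0}\left(-\frac{c}{2}+I_{uric}(c,\beta)+I_{sph}(c,\alpha)\right)<\xi_{uric}^{(u,low)}.$$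 Then $$\lim_{n\rightarrow\infty}P\left(\xi_{uric}\leq \xi_{uric}^{(u,low)}\sqrt{m}\right)=1,\quad\text{equivalently}\quad \lim_{n\rightarrow\infty}P\left(\xi_{uric}^2\leq (\xi_{uric}^{(u,low)})^2 m\right)=1.$$
   Context: $S_{ric}=\{\mathbf{x}\in S^{n-1} : \|\mathbf{x}\|_{\ell_0}=k\}$, where $S^{n-1}$ is the Euclidean unit sphere in $\mathbb{R}^n$ and $\|\mathbf{x}\|_{\ell_0}$ is the number of nonzero components of $\mathbf{x}$. The maximum over $S_{ric}$ is understood as a supremum. The relations $k=\beta n$, $m=\alpha n$ are understood up to rounding to integers (e.g. $k=\lfloor\beta n\rfloor$, $m=\lfloor\alpha n\rfloor$). $\mathrm{erf}(x)=\frac{2}{\sqrt{\pi}}\int_0^x e^{-t^2}dt$ and $\mathrm{erfc}=1-\mathrm{erf}$. The quantity $I^{(uric)}(c,\gamma,\nu)$ equals $E\exp\left(c\max\{\frac{h^2}{4\gamma}-\nu,0\}\right)$ for a standard normal variable $h$. The variables $c,\gamma,\nu$ are written $c_3^{(s)},\gamma_{uric}^{(s)},\nu_{uric}^{(s)}$ in the paper. *)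

(* Defs.v *)
(* MathComp / MathComp-Analysis *)
From mathcomp Require Export all_boot all_order all_algebra.
From mathcomp Require Export all_classical all_reals all_analysis.
Export Order.TTheory GRing.Theory Num.Theory.
Export numFieldNormedType.Exports.

Set Implicit Arguments.
Unset Strict Implicit.
Unset Printing Implicit Defensive.

Local Open Scope classical_set_scope.
Local Open Scope ring_scope.

(* k is x rounded down or up, i.e. floor x or ceil x; it is x itself when x is
   an integer. *)
Definition is_rounding (R : realType) (x : R) (k : nat) : Prop :=
  `|k%:R - x| < 1.

(* The library norm on matrices is the sup norm. *)
Definition l2norm (R : realType) (n : nat) (x : 'cV[R]_n) : R :=
  Num.sqrt (\sum_(i < n) x i 0 ^+ 2).

Definition l0norm (R : realType) (n : nat) (x : 'cV[R]_n) : nat :=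
  #|[set i : 'I_n | x i 0 != 0]%SET|.

Definition S_ric (R : realType) (n k : nat) : set 'cV[R]_n :=
  [set x | l2norm x = 1 /\ l0norm x = k].

(* The set is bounded, and it is nonempty when 0 < k <= n; for k = 0 the
   supremum of the empty set is 0. *)
Definition xi_uric (R : realType) (m n k : nat) (A : 'M[R]_(m, n)) : R :=
  sup [set l2norm (A *m x) | x in @S_ric R n k].

Definition mutually_independent (d : measure_display) (T : measurableType d)
    (R : realType) (P : probability T R) (I : finType)
    (X : I -> {RV P >-> R}) : Prop :=
  forall (J : {set I}) (B : I -> set R), (forall i, measurable (B i)) ->
    P (\bigcap_(i in [set` J]) (X i @^-1` B i)) =
    (\prod_(i in J) P (X i @^-1` B i))%E.

Definition iid_std_normal (d : measure_display) (T : measurableType d)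
    (R : realType) (P : probability T R) (I : finType)
    (X : I -> {RV P >-> R}) : Prop :=
  mutually_independent X /\
  (forall (i : I) (B : set R), measurable B ->
     distribution P (X i) B = normal_prob 0 1 B).

(* For x < 0 only the second integral survives, which gives the usual sign
   convention for the integral from 0 to x. *)
Definition erf (R : realType) (x : R) : R :=
  2 / Num.sqrt pi *
  (\int[lebesgue_measure]_(t in `[0, x]) expR (- t ^+ 2) -
   \int[lebesgue_measure]_(t in `[x, 0]) expR (- t ^+ 2)).

Definition erfc (R : realType) (x : R) : R := 1 - erf x.

Definition gamma_hat (R : realType) (c alpha : R) : R :=
  (2 * c + Num.sqrt (4 * c ^+ 2 + 16 * alpha)) / 8.

Definition I_sph (R : realType) (c alpha : R) : R :=
  gamma_hat c alpha
  - alpha / (2 * c) * ln (1 - c / (2 * gamma_hat c alpha)).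

(* For c > 0, gam > c / 2 and nu >= 0 this is the closed form of
   E exp (c * max (h ^ 2 / (4 * gam) - nu) 0) with h standard normal; in
   particular it is at least 1. *)
Definition I_uric_fun (R : realType) (c gam nu : R) : R :=
  let p := c / (4 * gam) in
  let r := - (c * nu) in
  let C := expR r / Num.sqrt (1 - 2 * p) in
  let a := 2 * Num.sqrt (nu * gam) * Num.sqrt (1 - 2 * p) in
  C * erfc (a / Num.sqrt 2) + (1 - erfc (Num.sqrt (2 * nu * gam))).

(* The logarithm is nonnegative, so for beta >= 0 the set is bounded below by
   c / 2 and inf is the genuine infimum. *)
Definition I_uric (R : realType) (c beta : R) : R :=
  inf [set nu * beta + gam + c^-1 * ln (I_uric_fun c gam nu)
      | gam in `]c / 2, +oo[ & nu in `[0, +oo[].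

(* Bounded below by 0 for alpha, beta >= 0: I_uric c beta >= c / 2 and
   I_sph c alpha >= 0. *)
Definition uric_bound (R : realType) (alpha beta : R) : R :=
  (Num.sqrt alpha)^-1 *
  inf [set - (c / 2) + I_uric c beta + I_sph c alpha | c in `]0, +oo[].

(* Main.v *)
From HB Require Import structures.
Require Import Defs.
From mathcomp Require Import measurable_realfun ring lra.

(** Write xi for the maximal stretch of the Gaussian matrix A, so that xi is
    the supremum of y^T A x over unit vectors y and unit vectors x with exactly
    k nonzero entries.  The proof bounds the exponential moment of xi; the
    limits then follow from convexity of exp (for the mean) and from the
    Chernoff bound (for the tail).

    The exponential moment comes from a comparison of two Gaussian processes
    indexed by the pairs (x, y): y^T A x + z, with z an extra standard normal
    variable, and y.g + x.h, with g and h independent standard normal vectors.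
    Both have variance 2, and their covariances at (x, y) and (x', y') differ
    by (1 - <x, x'>) (1 - <y, y'>) >= 0 (cov_le).  The less correlated process
    has the larger maximum, whence
      exp (c^2 / 2) E exp (c xi) <= E exp (c sup (y.g + x.h)).
    On the right-hand side the supremum is linearized by the inequality
    a b <= g b^2 + a^2 / (4 g): with the constraints on x and y, for all
    g1, g2 > 0 and nu >= 0,
      y.g <= g1 + sum_i g_i^2 / (4 g1),
      x.h <= g2 + nu k + sum_j max (h_j^2 / (4 g2) - nu) 0   (sum_dir_le).
    The bound no longer depends on (x, y) and is a sum of functions of single
    coordinates, so its exponential moment is a product of one-dimensional
    integrals: the factors (1 - c / (2 g1))^(-1/2) and I_uric_fun c g2 nu
    (xi_mgf_le).  Replacing c, g1, g2, nu by c sqrt n, g1 sqrt n, g2 sqrt n and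
    nu / sqrt n leaves the factors unchanged and turns the bound into
    exp (n c r + O(1)), where r is the expression under the infima that define
    uric_bound sqrt alpha (xi_mgf_rate).

    The comparison is proved for the smooth function F u = (sum_t e^(theta u_t))^q
    with theta q = c and 0 < q < 1, which lies between e^(c max u) and
    N^q e^(c max u); letting q tend to 0 gives the exponential of the maximum
    over N pairs.  A Gaussian vector with directions s is represented by the
    averaging operator gconv s, that is F |-> E F (u + sum_l z_l s_l).  Since
    (z + z') / sqrt 2 is again standard normal, and since averaging operators
    commute, the operator at scale 1 is a 2^r-fold composition of operators at
    scale d = 2^(-r/2); it therefore suffices to compare the two operators
    at a small scale d up to a factor 1 + O(d^3) (softmax_step,
    slepian_softmax).  At a small scale, F (u + v) / F u = T^q where
    T = sum_i p_i e^(theta v_i) for probability weights p_i, and up to O(d^3) the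
    mean of T^q is a combination of E T and E T^2 in which E T^2 has the
    coefficient - q (1 - q) / 2.  The mean of T depends on the variances only,
    while E T^2 increases with the covariances: more correlation makes
    E T^q smaller (gaussE_powR).

    The passage from finitely many pairs to the supremum uses a sequence of
    pairs along which every bilinear form approaches its supremum; this also
    gives the measurability of xi (exists_dense_pairs). *)

Set Implicit Arguments.
Unset Strict Implicit.
Unset Printing Implicit Defensive.

Local Open Scope classical_set_scope.
Local Open Scope ring_scope.

(** * Gaussian integrals on the real line *)

Lemma ge0_integralZ (R : realType) d (T : measurableType d)
    (m : {measure set T -> \bar R}) (k : R) (f : T -> \bar R) : 0 <= k ->
  measurable_fun [set: T] f -> (forall x, (0 <= f x)%E) ->
  (\int[m]_x (k%:E * f x) = k%:E * \int[m]_x f x)%E.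
Proof. by move=> k0 mf f0; rewrite ge0_integralZl_EFin. Qed.

Lemma ge0_integralDT (R : realType) d (T : measurableType d)
    (m : {measure set T -> \bar R}) (f g : T -> \bar R) :
  measurable_fun [set: T] f -> (forall x, (0 <= f x)%E) ->
  measurable_fun [set: T] g -> (forall x, (0 <= g x)%E) ->
  (\int[m]_x (f x + g x) = \int[m]_x f x + \int[m]_x g x)%E.
Proof. by move=> mf f0 mg g0; rewrite ge0_integralD. Qed.

Section gauss1.
Context {R : realType}.
Local Notation mu := (@lebesgue_measure R).
Local Notation gam := (@normal_prob R 0 1).
Local Open Scope ereal_scope.

(** Scaling and translating Lebesgue measure gives a measure that agrees with
    it on half-open intervals, hence everywhere. *)
Lemma lebesgue_affine (a b : R) (f : R -> \bar R) : (0 < a)%R ->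
  measurable_fun [set: R] f -> (forall x, 0 <= f x) ->
  \int[mu]_x f x = a%:E * \int[mu]_x f (a * x + b)%R.
Proof.
move=> a0 mf f0.
pose h : measurableTypeR R -> measurableTypeR R := fun x => (a * x + b)%R.
have mh : measurable_fun setT h.
  by apply: measurable_funD => //; exact: measurable_funM.
pose pf := measure_function_pushforward__canonical__measure_function_Measure mu mh.
pose nu := mscale (NngNum (ltW a0)) pf.
have E A : measurable A -> mu A = nu A.
  move=> mA; rewrite (@lebesgue_measure_unique _ nu)//.
  move=> _ [[x y]] _ <-.
  transitivity (a%:E * mu (h @^-1` `]x, y]%classic)); last by [].
  have -> : h @^-1` `]x, y]%classic = `]((x - b) / a)%R, ((y - b) / a)%R]%classic.
    apply/seteqP; split => z /=; rewrite !in_itv/= /h ltr_pdivrMr// ler_pdivlMr// mulrC.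
    by rewrite ltrBlDr lerBrDr.
    by rewrite ltrBlDr lerBrDr.
  rewrite !lebesgue_measure_itv/= !lte_fin ltr_pM2r ?invr_gt0// ltrD2r.
  case: ifPn => _; last by rewrite mule0.
  by rewrite -!EFinB -EFinM; congr EFin; field; rewrite gt_eqF.
transitivity (\int[nu]_x f x).
  by apply: eq_measure_integral => A mA _; exact: E.
rewrite /nu ge0_integral_mscale//=; congr *%E.
by rewrite ge0_integral_pushforward//.
Qed.

Lemma normal_pdf01E (x : R) : normal_pdf 0 1 x = ((Num.sqrt (pi *+ 2))^-1 * expR (- x ^+ 2 / 2))%R.
Proof.
rewrite normal_pdfE ?oner_neq0// /normal_peak /normal_fun expr1n mul1r subr0.
by rewrite mulNr.
Qed.

Lemma integral_gam (f : R -> \bar R) :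
  measurable_fun [set: R] f -> (forall x, 0 <= f x) ->
  \int[gam]_x f x = \int[mu]_x (f x * (normal_pdf 0 1 x)%:E).
Proof.
move=> mf f0.
rewrite -(Radon_Nikodym_SigmaFinite.change_of_variables (normal_prob_dominates 0 1))//.
have dom := normal_prob_dominates (0:R) 1.
apply: ae_eq_integral => //.
- apply: emeasurable_funM => //.
  exact: measurable_int (Radon_Nikodym_SigmaFinite.f_integrable dom).
- by apply: emeasurable_funM => //; apply/measurable_EFinP; exact: measurable_normal_pdf.
- apply: ae_eqe_mul2l => /=; apply: integral_ae_eq => //=.
  + exact: Radon_Nikodym_SigmaFinite.f_integrable.
  + by apply/measurable_EFinP; exact: measurable_normal_pdf.
  + by move=> E _ mE; rewrite -Radon_Nikodym_SigmaFinite.f_integral.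
Qed.

Local Notation phi := (@normal_pdf R 0 1).

Lemma mphi : measurable_fun [set: R] (EFin \o phi).
Proof. by apply/measurable_EFinP; exact: measurable_normal_pdf. Qed.

Lemma phi_ge0 x : (0 <= phi x)%R.
Proof. exact: normal_pdf_ge0. Qed.

(** Stability of the standard normal law under (z + y) / sqrt 2, for extended
    real valued functions.  After the substitution w = (z + y) / sqrt 2 it comes
    down to the rotation invariance of the product density,
    phi z phi (sqrt 2 w - z) = phi w phi (sqrt 2 z - w). *)
Lemma gam_rotation (f : R -> \bar R) :
  measurable_fun [set: R] f -> (forall x, 0 <= f x) ->
  \int[gam]_z \int[gam]_y f ((z + y) / Num.sqrt 2)%R = \int[gam]_x f x.
Proof.
move=> mf f0; set s := Num.sqrt 2.
have s0 : (0 < s)%R by rewrite sqrtr_gt0.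
have s2 : (s * s = 2)%R by rewrite -expr2 sqr_sqrtr.
have mfzy : measurable_fun [set: R * R] (fun zy : R * R => f ((zy.1 + zy.2) / s)%R).
  apply: measurableT_comp => //.
  by apply: measurable_funM => //; exact: measurable_funD.
have inner z : \int[gam]_y f ((z + y) / s)%R = \int[mu]_w (s%:E * (f w * (phi (s * w - z))%:E)).
  rewrite integral_gam//; last first.
    by apply: measurableT_comp => //; apply: measurable_funM => //; exact: measurable_funD.
  rewrite (@lebesgue_affine s (- z))//; last 2 first.
  - apply: emeasurable_funM; last exact: mphi.
    by apply: measurableT_comp => //; apply: measurable_funM => //; exact: measurable_funD.
  - by move=> y; rewrite mule_ge0// lee_fin phi_ge0.
  rewrite -ge0_integralZl//=; last 3 first.
  - apply: emeasurable_funM.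
      apply: measurableT_comp => //; apply: measurable_funM => //; apply: measurable_funD => //.
      by apply: measurable_funD => //; exact: measurable_funM.
    apply: (measurableT_comp mphi).
    by apply: measurable_funD => //; exact: measurable_funM.
  - by move=> y _; rewrite mule_ge0// lee_fin phi_ge0.
  - by rewrite lee_fin ltW.
  apply: eq_integral => w _; congr (_ * (f _ * _)).
  by field; rewrite gt_eqF.
have key z w : (phi (s * w - z) * phi z = phi w * phi (s * z - w))%R.
  rewrite !normal_pdf01E mulrACA [RHS]mulrACA; congr (_ * _)%R; rewrite -!expRD; congr expR.
  rewrite !sqrrB !exprMn expr2 s2.
  by field.
have mker : measurable_fun [set: R * R] (fun zw : R * R =>
   s%:E * (f zw.2 * (phi (s * zw.2 - zw.1))%:E) * (phi zw.1)%:E).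
  apply: emeasurable_funM; last first.
    exact: (measurableT_comp mphi).
  apply: emeasurable_funM => //; apply: emeasurable_funM => //.
    exact: measurableT_comp.
  apply: (measurableT_comp mphi).
  by apply: measurable_funB => //; exact: measurable_funM.
rewrite integral_gam//; last 2 first.
- exact: (measurable_fun_fubini_tonelli_F (m2 := gam) _ mfzy).
- by move=> z; exact: integral_ge0.
transitivity (\int[mu]_z \int[mu]_w (s%:E * (f w * (phi (s * w - z))%:E) * (phi z)%:E)).
  apply: eq_integral => z _; rewrite inner -ge0_integralZr//=.
  - apply: emeasurable_funM => //; apply: emeasurable_funM => //.
    apply: (measurableT_comp mphi).
    by apply: measurable_funB => //; exact: measurable_funM.
  - by move=> w _; rewrite mule_ge0 ?lee_fin ?(ltW s0)// mule_ge0// lee_fin phi_ge0.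
  - by rewrite lee_fin phi_ge0.
transitivity (\int[mu]_w \int[mu]_z (s%:E * (f w * (phi (s * w - z))%:E) * (phi z)%:E)).
  apply: (fubini_tonelli (m1 := mu) (m2 := mu) _ mker) => -[z w] /=.
  rewrite mule_ge0 ?lee_fin ?phi_ge0//.
  by rewrite mule_ge0 ?lee_fin ?(ltW s0)// mule_ge0// lee_fin phi_ge0.
rewrite integral_gam//; apply: eq_integral => w _.
transitivity (\int[mu]_z (f w * (phi w)%:E * (s%:E * (phi (s * z + - w))%:E))).
  apply: eq_integral => z _.
  rewrite muleC !muleA -EFinM (muleC _ (f w)) -!muleA; congr (_ * _).
  rewrite -!EFinM; congr EFin; have := key z w; rewrite /=.
  by move=> K; rewrite mulrCA -K; ring.
have mz : measurable_fun [set: R] (fun z : R => (phi (s * z + - w))%:E).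
  apply: (measurableT_comp mphi).
  by apply: measurable_funD => //; exact: measurable_funM.
rewrite ge0_integralZl//=; last 3 first.
- by apply: emeasurable_funM.
- by move=> z _; rewrite mule_ge0 ?lee_fin ?(ltW s0) ?phi_ge0.
- by rewrite mule_ge0// lee_fin phi_ge0.
rewrite ge0_integralZl//=; last 2 first.
- by move=> z _; rewrite lee_fin phi_ge0.
- by rewrite lee_fin ltW.
rewrite -(@lebesgue_affine s (- w) (EFin \o phi))//; last 2 first.
- exact: mphi.
- by move=> x; rewrite lee_fin phi_ge0.
by rewrite integral_normal_pdf mule1.
Qed.

Lemma gam_expR (t : R) : \int[gam]_z (expR (t * z))%:E = (expR (t ^+ 2 / 2))%:E.
Proof.
have mE : measurable_fun [set: R] (fun z : R => (expR (t * z))%:E).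
  by apply/measurable_EFinP; apply: measurableT_comp => //; exact: measurable_funM.
rewrite integral_gam//.
transitivity (\int[mu]_z ((expR (t ^+ 2 / 2))%:E * (phi (1 * z + - t))%:E)).
  apply: eq_integral => z _; rewrite -!EFinM; congr EFin.
  rewrite !normal_pdf01E mulrCA [RHS]mulrCA -!expRD; congr (_ * expR _)%R.
  by field.
have mz : measurable_fun [set: R] (fun z : R => (phi (1 * z + - t))%:E).
  apply: (measurableT_comp mphi).
  by apply: measurable_funD => //; exact: measurable_funM.
rewrite ge0_integralZl//=; last by move=> z _; rewrite lee_fin phi_ge0.
rewrite -[X in _ * X]mul1e -(@lebesgue_affine 1 (- t) (EFin \o phi))//; last 2 first.
- exact: mphi.
- by move=> x; rewrite lee_fin phi_ge0.
by rewrite integral_normal_pdf mule1.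
Qed.

(** Multiplying the normal density by the exponential of a square only
    rescales its argument; both integrals with quadratic exponents below rest on
    this. *)
Lemma phi_scale (p x : R) : (p < 2^-1)%R ->
  (expR (p * x ^+ 2) * phi x = phi (Num.sqrt (1 - 2 * p) * x))%R.
Proof.
move=> p2; rewrite !normal_pdf01E mulrCA -expRD; congr (_ * expR _)%R.
rewrite exprMn sqr_sqrtr; last by lra.
by field.
Qed.

Lemma gam_expR_sqr (p : R) : (p < 2^-1)%R ->
  \int[gam]_z (expR (p * z ^+ 2))%:E = (Num.sqrt (1 - 2 * p))^-1%:E.
Proof.
move=> p2; have r0 : (0 < Num.sqrt (1 - 2 * p))%R by rewrite sqrtr_gt0; lra.
have mE : measurable_fun [set: R] (fun z : R => (expR (p * z ^+ 2))%:E).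
  by apply/measurable_EFinP; apply: measurableT_comp => //; exact: measurable_funM.
rewrite integral_gam//.
under eq_integral do rewrite -EFinM phi_scale//.
set r := Num.sqrt _ in r0 *.
rewrite -[LHS]mul1e -[X in X%:E * _](mulVf (negbT (gt_eqF r0))) EFinM -muleA.
have /= := @lebesgue_affine _ 0 (EFin \o phi) r0 mphi (fun x => phi_ge0 x).
under [in X in _ = X]eq_integral do rewrite addr0.
by move=> <-; rewrite integral_normal_pdf mule1.
Qed.

Lemma sqrt_pi2 : (Num.sqrt (pi *+ 2) = Num.sqrt 2 * Num.sqrt pi :> R)%R.
Proof. by rewrite -[(pi *+ 2)%R]mulr_natl sqrtrM. Qed.

Lemma ge0_Rintegral_fin (D : set R) (f : R -> R) :
  (\int[mu]_(x in D) (f x)%:E < +oo) -> (forall x, 0 <= f x)%R ->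
  (\int[mu]_(x in D) f x)%R%:E = \int[mu]_(x in D) (f x)%:E.
Proof.
move=> foo f0; rewrite /Rintegral fineK// ge0_fin_numE//.
by apply: integral_ge0 => x _; rewrite lee_fin.
Qed.

Lemma lebesgue_opp (f : R -> \bar R) :
  measurable_fun [set: R] f -> (forall x, 0 <= f x) ->
  \int[mu]_x f (- x)%R = \int[mu]_x f x.
Proof.
move=> mf f0.
have mN : measurable_fun [set: measurableTypeR R] (-%R : _ -> measurableTypeR R).
  exact: oppr_measurable.
transitivity (\int[pushforward mu (-%R : _ -> measurableTypeR R)]_x f x).
  by rewrite ge0_integral_pushforward.
by apply: eq_measure_integral => A mA _; exact: lebesgue_measureN.
Qed.

(** Symmetric form of the error function, which is the one that matches the
    event |h| < a for a normal variable h. *)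
Lemma erf_ge0E (b : R) : (0 <= b)%R ->
  (erf b)%:E = (Num.sqrt pi)^-1%:E * \int[mu]_(t in [set t | `|t| < b]%R) (expR (- t ^+ 2))%:E.
Proof.
move=> b0.
have mgauss : measurable_fun [set: R] (fun x : R => (expR (- x ^+ 2))%:E).
  by apply/measurable_EFinP; exact: measurable_gauss_fun.
have Ifin : \int[mu]_(t in `[0%R, b]) (expR (- t ^+ 2))%:E < +oo.
  apply: (@le_lt_trans _ _ (\int[mu]_t (expR (- t ^+ 2))%:E)).
    apply: ge0_subset_integral => //=.
  by rewrite integralT_gauss ltry.
have -> : erf b = (2 / Num.sqrt pi * \int[mu]_(t in `[0%R, b]) expR (- t ^+ 2))%R.
  rewrite /erf; congr (_ * _)%R; rewrite -[RHS]subr0; congr (_ - _)%R.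
  rewrite /Rintegral.
  have -> : \int[mu]_(t in `[b, 0%R]) (expR (- t ^+ 2))%:E = 0; last by [].
  rewrite (@integral_Sset1 _ _ _ 0%R)// => x /=; rewrite in_itv/= => /andP[bx x0].
  by apply/eqP; rewrite eq_le x0 (le_trans b0).
rewrite EFinM ge0_Rintegral_fin//.
rewrite (mulrC 2%R) EFinM -muleA; congr (_ * _).
have -> : [set x : R | `|x| < b]%R = `[0%R, b[%classic `|` `](- b)%R, 0%R[%classic.
  apply/seteqP; split => x /=; rewrite !in_itv/= ltr_norml.
    by move=> /andP[-> ->]; rewrite andbT; apply/orP; case: ltP.
  case=> /andP[h1 h2]; apply/andP; split => //.
    by rewrite (lt_le_trans _ h1)// oppr_lt0 (le_lt_trans h1).
  by rewrite (lt_le_trans h2).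
rewrite ge0_integral_setU//=; last 2 first.
- exact/measurable_funTS.
- apply/disj_setPS => x /= []; rewrite !in_itv/= => /andP[x0 _] /andP[_].
  by rewrite ltNge x0.
have -> : \int[mu]_(x in `](- b)%R, 0%R[) (expR (- x ^+ 2))%:E =
    \int[mu]_(x in `[0%R, b]) (expR (- x ^+ 2))%:E.
  rewrite -integral_itv_obnd_cbnd -?integral_itv_bndo_bndc; last 2 first.
  - exact/measurable_funTS.
  - exact/measurable_funTS.
  rewrite integral_mkcond -lebesgue_opp; last 2 first.
  - by apply/measurable_restrict => //; exact: measurable_funTS.
  - by move=> x; apply: erestrict_ge0 => y _; rewrite lee_fin expR_ge0.
  rewrite [RHS]integral_mkcond; apply: eq_integral => x _.
  rewrite !patchE sqrrN; congr (if _ then _ else _).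
  by rewrite !mem_setE !in_itv/= ltrN2 oppr_lt0 andbC.
rewrite integral_itv_bndo_bndc; last exact/measurable_funTS.
by rewrite mule_natl mule2n.
Qed.

Lemma gam_lt (a : R) : (0 <= a)%R ->
  gam [set x | `|x| < a]%R = (erf (a / Num.sqrt 2))%:E.
Proof.
move=> a0.
have r0 : (0 < Num.sqrt 2 :> R)%R by rewrite sqrtr_gt0.
have p0 : (0 < Num.sqrt pi :> R)%R by rewrite sqrtr_gt0 pi_gt0.
have mgauss : measurable_fun [set: R] (fun x : R => (expR (- x ^+ 2))%:E).
  by apply/measurable_EFinP; exact: measurable_gauss_fun.
have mA (c : R) : measurable [set x : R | `|x| < c]%R.
  rewrite (_ : [set x | _] = `](- c)%R, c[%classic); first exact: measurable_itv.
  by apply/seteqP; split => x /=; rewrite in_itv/= ltr_norml.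
rewrite erf_ge0E ?divr_ge0 ?(ltW r0)// /normal_prob integral_mkcond.
rewrite (@lebesgue_affine _ 0%R _ r0); last 2 first.
- by apply/measurable_restrict => //; apply: measurable_funTS; exact: mphi.
- by move=> x; apply: erestrict_ge0 => y _; rewrite lee_fin phi_ge0.
rewrite [in RHS]integral_mkcond -ge0_integralZ; last 3 first.
- by rewrite ltW.
- apply: (@measurableT_comp _ _ _ _ _ _ ((EFin \o phi) \_ [set x | (`|x| < a)%R])).
    by apply/measurable_restrict => //; apply: measurable_funTS; exact: mphi.
  by apply: measurable_funD => //; exact: measurable_funM.
- by move=> x; apply: erestrict_ge0 => y _; rewrite lee_fin phi_ge0.
rewrite -ge0_integralZ; last 3 first.
- by rewrite invr_ge0 ltW.
- apply/(measurable_restrictT _ (mA _)); apply: measurable_funTS; exact: mgauss.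
- by move=> x; apply: erestrict_ge0 => y _; rewrite lee_fin expR_ge0.
apply: eq_integral => x _; rewrite !patchE addr0.
have -> : ((Num.sqrt 2 * x)%R \in [set x | (`|x| < a)%R]) =
          (x \in [set t | (`|t| < a / Num.sqrt 2)%R]).
  by apply/idP/idP; rewrite !inE/= normrM (gtr0_norm r0) ltr_pdivlMr// mulrC.
case: ifPn => _; last by rewrite !mule0.
rewrite -!EFinM; congr EFin; rewrite normal_pdf01E sqrt_pi2.
rewrite exprMn sqr_sqrtr// invfM !mulrA divff ?gt_eqF// mul1r; congr (_ * expR _)%R.
by field.
Qed.

Lemma gam_ge (a : R) : (0 <= a)%R ->
  gam (~` [set x | `|x| < a]%R) = (erfc (a / Num.sqrt 2))%:E.
Proof.
move=> a0.
have mA : measurable [set x : R | `|x| < a]%R.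
  rewrite (_ : [set x | _] = `](- a)%R, a[%classic); first exact: measurable_itv.
  by apply/seteqP; split => x /=; rewrite in_itv/= ltr_norml.
have := probability_setC gam mA.
by rewrite [X in _ = 1 - X -> _]gam_lt// -EFinB.
Qed.

(** The maximum is positive exactly when |h| >= 2 sqrt (nu g).  Inside, the
    integrand is 1; outside, the quadratic exponent is absorbed in the density
    by phi_scale, which turns the threshold 2 sqrt (nu g) into the number a of
    the closed form. *)
Lemma gam_uric (c g nu : R) : (0 < c)%R -> (c / 2 < g)%R -> (0 <= nu)%R ->
  \int[gam]_h (expR (c * Num.max (h ^+ 2 / (4 * g) - nu) 0))%:E =
  (I_uric_fun c g nu)%:E.
Proof.
move=> c0 cg nu0.
have g0 : (0 < g)%R by lra.
set p := (c / (4 * g))%R.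
have p2 : (p < 2^-1)%R by rewrite /p ltr_pdivrMr ?mulr_gt0//; lra.
set t := (2 * Num.sqrt (nu * g))%R.
have t0 : (0 <= t)%R by rewrite mulr_ge0// sqrtr_ge0.
have r0 : (0 < Num.sqrt (1 - 2 * p))%R by rewrite sqrtr_gt0; lra.
have mA (x : R) : measurable [set h : R | `|h| < x]%R.
  rewrite (_ : [set h | _] = `](- x)%R, x[%classic); first exact: measurable_itv.
  by apply/seteqP; split => h /=; rewrite in_itv/= ltr_norml.
have mE : measurable_fun [set: R]
    (fun h : R => (expR (c * Num.max (h ^+ 2 / (4 * g) - nu) 0))%:E).
  apply/measurable_EFinP; apply: measurableT_comp => //.
  apply: measurable_funM => //; apply: measurable_maxr => //.
  by apply: measurable_funB => //; exact: measurable_funM.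
have tP h : (`|h| < t)%R = (h ^+ 2 / (4 * g) < nu)%R.
  rewrite ltr_pdivrMr ?mulr_gt0// -real_normK ?num_real//.
  rewrite -(@ltr_pXn2r _ 2) ?nnegrE// /t exprMn sqr_sqrtr ?mulr_ge0 ?(ltW g0)//.
  by congr (_ < _)%R; ring.
transitivity (\int[gam]_h ((\1_[set h | `|h| < t]%R h)%:E +
   (expR (- (c * nu)))%:E * ((expR (p * h ^+ 2))%:E * (\1_(~` [set h | `|h| < t]%R) h)%:E))).
  apply: eq_integral => h _; rewrite !indicE in_setC.
  have -> : (h \in [set h0 : R | `|h0| < t]%R) = (`|h| < t)%R.
    by apply/idP/idP; rewrite inE.
  rewrite tP; case: ltP => ht.
    rewrite !mule0 adde0 max_r; last by rewrite subr_le0 ltW.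
    by rewrite mulr0 expR0.
  rewrite max_l ?subr_ge0// mule1 add0e -EFinM -expRD; congr (expR _)%:E.
  by rewrite /p; field; rewrite gt_eqF.
have m1 (A : set R) : measurable A -> measurable_fun [set: R] (fun h => (\1_A h)%:E : \bar R).
  by move=> mA'; apply/measurable_EFinP; exact: measurable_indic.
have ind (A : set R) : measurable A -> \int[gam]_h (\1_A h)%:E = gam A.
  by move=> mA'; rewrite integral_indic// setIT.
have mexp : measurable_fun [set: R] (fun h : R => (expR (p * h ^+ 2))%:E).
  by apply/measurable_EFinP; apply: measurableT_comp => //; exact: measurable_funM.
have mC (x : R) : measurable (~` [set h : R | `|h| < x]%R) by exact: measurableC.
have m2 : measurable_fun [set: R]
   (fun h : R => (expR (p * h ^+ 2))%:E * (\1_(~` [set h | `|h| < t]%R) h)%:E).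
  by apply: emeasurable_funM => //; exact: m1.
have p2' (h : R) : 0 <= (expR (p * h ^+ 2))%:E * (\1_(~` [set h | `|h| < t]%R) h)%:E.
  by rewrite mule_ge0// lee_fin ?expR_ge0.
rewrite ge0_integralDT; last 4 first.
- exact: m1.
- by move=> h; rewrite lee_fin.
- exact: measurable_funeM.
- by move=> h; rewrite mule_ge0// lee_fin expR_ge0.
rewrite ind// ge0_integralZ ?expR_ge0// integral_gam//.
have -> : \int[mu]_h ((expR (p * h ^+ 2))%:E * (\1_(~` [set h | (`|h| < t)%R]) h)%:E * (phi h)%:E)
   = \int[mu]_h ((\1_(~` [set h | (`|h| < Num.sqrt (1 - 2 * p) * t)%R])
        (Num.sqrt (1 - 2 * p) * h + 0)%R)%:E * (phi (Num.sqrt (1 - 2 * p) * h + 0))%:E).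
  apply: eq_integral => h _; rewrite addr0 -phi_scale//.
  have -> : (\1_(~` [set h0 : R | (`|h0| < Num.sqrt (1 - 2 * p) * t)%R]) (Num.sqrt (1 - 2 * p) * h)%R : R) =
      \1_(~` [set h0 : R | (`|h0| < t)%R]) h.
    rewrite !indicE !in_setC; congr ((~~ _)%:R).
    by apply/idP/idP; rewrite !inE/= normrM (gtr0_norm r0) ltr_pM2l.
  by rewrite EFinM [RHS]muleA [X in X * _ = _]muleC.
have := @lebesgue_affine _ 0%R (fun h => (\1_(~` [set h | (`|h| < Num.sqrt (1 - 2 * p) * t)%R]) h)%:E * (phi h)%:E) r0.
rewrite -integral_gam//; last exact: m1.
rewrite ind// => H.
set X := (X in _ + _ * X).
have {}H : X = (Num.sqrt (1 - 2 * p))^-1%:E * gam (~` [set h | (`|h| < Num.sqrt (1 - 2 * p) * t)%R]).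
  rewrite H; last 2 first.
  - by apply: emeasurable_funM; [exact: m1|exact: mphi].
  - by move=> x; rewrite mule_ge0// lee_fin phi_ge0.
  by rewrite muleA -EFinM mulVf ?gt_eqF// mul1e.
rewrite H gam_lt// gam_ge ?mulr_ge0 ?(ltW r0)//.
rewrite -!EFinM -EFinD; congr EFin.
rewrite /I_uric_fun -/p addrC; congr (_ + _)%R.
  by rewrite /erfc mulrA /t (mulrC (Num.sqrt (1 - 2 * p))).
rewrite /erfc subKr; congr erf; rewrite /t -mulrA [RHS]sqrtrM//.
have s0 : (0 < Num.sqrt 2 :> R)%R by rewrite sqrtr_gt0.
rewrite -[X in (X * _ / _)%R](@sqr_sqrtr _ 2)//.
by field; rewrite gt_eqF.
Qed.

End gauss1.

(** * Gaussian averaging operators on row vectors *)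

Definition rV_display : measure_display.
Proof. by constructor. Qed.

Section measurable_rV.
Context {R : realType} {N : nat}.

Let coords : 'I_N -> 'rV[R]_N -> R := fun i v => v 0 i.

Let rV_set0 : g_sigma_preimage coords set0.
Proof. exact: sigma_algebra0. Qed.

Let rV_setC A : g_sigma_preimage coords A -> g_sigma_preimage coords (~` A).
Proof. exact: sigma_algebraC. Qed.

Let rV_bigcup (F : _^nat) : (forall i, g_sigma_preimage coords (F i)) ->
  g_sigma_preimage coords (\bigcup_i (F i)).
Proof. exact: sigma_algebra_bigcup. Qed.

(** Row vectors carry the sigma-algebra generated by the coordinates, so that
    measurability of a vector-valued map is measurability of its entries. *)
HB.instance Definition _ := @isMeasurable.Build rV_display
  'rV[R]_N (g_sigma_preimage coords) rV_set0 rV_setC rV_bigcup.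

Lemma measurable_fun_rVP d (T : measurableType d) (f : T -> 'rV[R]_N) :
  measurable_fun [set: T] f <->
  forall i, measurable_fun [set: T] (fun x => f x 0 i).
Proof.
apply: (@iff_trans _ (g_sigma_preimage (fun i => coords i \o f) `<=` measurable)).
  rewrite g_sigma_preimage_comp; split=> [mf A [/= C preC <-]|prefS].
    exact: mf.
  by move=> _ A mA; apply: prefS; exists A.
split=> [tnthfS i|mf].
- move=> _ A mA.
  apply: tnthfS; apply: sub_sigma_algebra.
  rewrite -bigcup_seq/=; exists i => /=; first by rewrite mem_index_enum.
  by exists A.
- apply: smallest_sub; first exact: sigma_algebra_measurable.
  rewrite -bigcup_seq; apply: bigcup_sub => i Ii.
  by move=> A [B mB <-]; exact: mf.
Qed.

Lemma measurable_coord (i : 'I_N) : measurable_fun [set: 'rV[R]_N] (fun v => v 0 i).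
Proof. by have /measurable_fun_rVP := @measurable_id _ 'rV[R]_N setT; exact. Qed.

Lemma measurable_rVD d (T : measurableType d) (f g : T -> 'rV[R]_N) :
  measurable_fun [set: T] f -> measurable_fun [set: T] g ->
  measurable_fun [set: T] (fun x => f x + g x).
Proof.
move=> /measurable_fun_rVP mf /measurable_fun_rVP mg; apply/measurable_fun_rVP => i.
rewrite (_ : (fun _ => _) = (fun x => f x 0 i + g x 0 i)); first exact: measurable_funD.
by apply/funext => x; rewrite mxE.
Qed.

Lemma measurable_rVZ d (T : measurableType d) (f : T -> R) (a : 'rV[R]_N) :
  measurable_fun [set: T] f -> measurable_fun [set: T] (fun x => f x *: a).
Proof.
move=> mf; apply/measurable_fun_rVP => i.
rewrite (_ : (fun _ => _) = (fun x => f x * a 0 i)); first exact: measurable_funM.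
by apply/funext => x; rewrite mxE.
Qed.

End measurable_rV.

Section gconv.
Context {R : realType} {N : nat}.
Local Notation gam := (@normal_prob R 0 1).
Local Notation V := 'rV[R]_N.
Local Open Scope ereal_scope.
Implicit Types (F G : V -> \bar R) (a b u v : V) (s : seq V).

Definition ge0_mfun F := measurable_fun [set: V] F /\ forall v, 0 <= F v.

(** Averaging over one normal variable in the direction [a]; the iterated
    operator [gconv s F] is the expectation of F (u + sum_l z_l s_l) for
    independent standard normal z_l.  Working with these operators on functions
    instead of a law on vectors makes commutation and splitting algebraic. *)
Definition gstep a F u := \int[gam]_z F (u + z *: a)%R.

Definition gconv s F : V -> \bar R := foldr gstep F s.

Lemma ge0_mfun_comp d (T : measurableType d) F (f : T -> V) : ge0_mfun F ->
  measurable_fun [set: T] f -> measurable_fun [set: T] (F \o f).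
Proof. by case=> mF _ mf; exact: measurableT_comp. Qed.

Lemma ge0_mfun_shift F u a : ge0_mfun F -> measurable_fun [set: R] (fun z => F (u + z *: a)%R).
Proof.
move=> nF; apply: (ge0_mfun_comp (f := fun z : R => (u + z *: a)%R)) => //.
by apply: measurable_rVD => //; exact: measurable_rVZ.
Qed.

Lemma ge0_mfun_gstep a F : ge0_mfun F -> ge0_mfun (gstep a F).
Proof.
move=> nF; split; last by move=> u; apply: integral_ge0 => z _; case: nF.
have mf : measurable_fun [set: V * R] (fun uz : V * R => F (uz.1 + uz.2 *: a)%R).
  apply: (ge0_mfun_comp (f := fun uz : V * R => (uz.1 + uz.2 *: a)%R)) => //.
  by apply: measurable_rVD => //; exact: measurable_rVZ.
apply: (measurable_fun_fubini_tonelli_F (m2 := gam) _ mf).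
by move=> ?; case: nF.
Qed.

Lemma ge0_mfun_gconv s F : ge0_mfun F -> ge0_mfun (gconv s F).
Proof. by move=> nF; elim: s => //= a s IH; exact: ge0_mfun_gstep. Qed.

Lemma ge0_mfunZ (k : R) F : (0 <= k)%R -> ge0_mfun F -> ge0_mfun (fun v => k%:E * F v).
Proof.
move=> k0 [mF F0]; split; first exact: measurable_funeM.
by move=> v; rewrite mule_ge0.
Qed.

Lemma gstepD a F G : ge0_mfun F -> ge0_mfun G ->
  gstep a (fun v => F v + G v) = (fun v => gstep a F v + gstep a G v).
Proof.
move=> nF nG; apply/funext => u; rewrite /gstep ge0_integralDT//;
  by [exact: ge0_mfun_shift | case: nF | case: nG].
Qed.

Lemma gstepZ a (k : R) F : (0 <= k)%R -> ge0_mfun F ->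
  gstep a (fun v => k%:E * F v) = (fun v => k%:E * gstep a F v).
Proof.
move=> k0 nF; apply/funext => u; rewrite /gstep ge0_integralZ//.
  exact: ge0_mfun_shift.
by case: nF.
Qed.

Lemma gstep_le a F G : ge0_mfun F -> ge0_mfun G -> (forall v, F v <= G v) ->
  forall u, gstep a F u <= gstep a G u.
Proof.
move=> nF nG FG u; apply: ge0_le_integral => //.
- by move=> z _; case: nF.
- exact: ge0_mfun_shift.
- exact: ge0_mfun_shift.
Qed.

Lemma gconvD s F G : ge0_mfun F -> ge0_mfun G ->
  gconv s (fun v => F v + G v) = (fun v => gconv s F v + gconv s G v).
Proof.
move=> nF nG; elim: s => //= a s ->.
by rewrite gstepD//; exact: ge0_mfun_gconv.
Qed.

Lemma gconvZ s (k : R) F : (0 <= k)%R -> ge0_mfun F ->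
  gconv s (fun v => k%:E * F v) = (fun v => k%:E * gconv s F v).
Proof.
move=> k0 nF; elim: s => //= a s ->.
by rewrite gstepZ//; exact: ge0_mfun_gconv.
Qed.

Lemma gconv_le s F G : ge0_mfun F -> ge0_mfun G -> (forall v, F v <= G v) ->
  forall u, gconv s F u <= gconv s G u.
Proof.
move=> nF nG FG; elim: s => //= a s IH.
by apply: gstep_le => //; exact: ge0_mfun_gconv.
Qed.

(** Tonelli; this is where nonnegativity replaces integrability. *)
Lemma gstepC a b F : ge0_mfun F -> gstep a (gstep b F) = gstep b (gstep a F).
Proof.
move=> nF; apply/funext => u; rewrite /gstep.
have mf : measurable_fun [set: R * R] (fun zy : R * R => F (u + zy.1 *: a + zy.2 *: b)%R).
  apply: (ge0_mfun_comp (f := fun zy : R * R => (u + zy.1 *: a + zy.2 *: b)%R)) => //.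
  apply: measurable_rVD; last exact: measurable_rVZ.
  by apply: measurable_rVD => //; exact: measurable_rVZ.
rewrite (fubini_tonelli (m1 := gam) (m2 := gam) _ mf); last by move=> ?; case: nF.
by apply: eq_integral => y _; apply: eq_integral => z _ /=; rewrite addrAC.
Qed.

Lemma gstep_gconvC a s F : ge0_mfun F -> gstep a (gconv s F) = gconv s (gstep a F).
Proof.
move=> nF; elim: s => //= b s IH.
by rewrite gstepC ?IH//; exact: ge0_mfun_gconv.
Qed.

Lemma gconvC s1 s2 F : ge0_mfun F -> gconv s1 (gconv s2 F) = gconv s2 (gconv s1 F).
Proof.
move=> nF; elim: s1 => //= a s1 ->.
by rewrite gstep_gconvC//; exact: ge0_mfun_gconv.
Qed.

Lemma gstep_half a F : ge0_mfun F ->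
  gstep ((Num.sqrt 2)^-1 *: a) (gstep ((Num.sqrt 2)^-1 *: a) F) = gstep a F.
Proof.
move=> nF; apply/funext => u; rewrite /gstep.
rewrite -(gam_rotation (f := fun z => F (u + z *: a)%R)); last 2 first.
- exact: ge0_mfun_shift.
- by move=> z; case: nF.
apply: eq_integral => z _; apply: eq_integral => y _.
by rewrite !scalerA -addrA -scalerDl -mulrDl.
Qed.

(** Splitting a Gaussian vector into two independent copies at scale
    1 / sqrt 2.  Iterating it reduces the comparison to small scales. *)
Lemma gconv_half s F : ge0_mfun F ->
  gconv [seq (Num.sqrt 2)^-1 *: a | a <- s] (gconv [seq (Num.sqrt 2)^-1 *: a | a <- s] F)
  = gconv s F.
Proof.
move=> nF; elim: s => //= a s IH.
rewrite -gstep_gconvC ?IH ?gstep_half//; do ?exact: ge0_mfun_gconv.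
Qed.

Lemma gstep_shift a F u v : gstep a (fun w => F (u + w)%R) v = gstep a F (u + v)%R.
Proof. by apply: eq_integral => z _; rewrite addrA. Qed.

Lemma gconv_shift s F u v : gconv s (fun w => F (u + w)%R) v = gconv s F (u + v)%R.
Proof.
elim: s v => //= a s IH v; rewrite -gstep_shift.
by congr gstep; apply/funext => w.
Qed.

Definition dot (t : 'I_N -> R) (v : V) : R := (\sum_i t i * v 0 i)%R.

Lemma dotD t u v : dot t (u + v)%R = (dot t u + dot t v)%R.
Proof. by rewrite /dot -big_split; apply: eq_bigr => i _; rewrite mxE mulrDr. Qed.

Lemma dotZ t k v : dot t (k *: v) = (k * dot t v)%R.
Proof. by rewrite /dot big_distrr; apply: eq_bigr => i _; rewrite mxE mulrCA. Qed.

Lemma measurable_dot t : measurable_fun [set: V] (dot t).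
Proof.
rewrite /dot; apply: measurable_sum => i.
by apply: measurable_funM => //; exact: measurable_coord.
Qed.

Definition expdot t v : \bar R := (expR (dot t v))%:E.

Lemma ge0_mfun_expdot t : ge0_mfun (expdot t).
Proof.
split; last by move=> v; rewrite lee_fin expR_ge0.
by apply/measurable_EFinP; apply: measurableT_comp => //; exact: measurable_dot.
Qed.

Lemma gstep_expdot a t :
  gstep a (expdot t) = (fun u => (expR (dot t a ^+ 2 / 2))%:E * expdot t u).
Proof.
apply/funext => u; rewrite /gstep /expdot.
under eq_integral do rewrite dotD dotZ addrC expRD mulrC EFinM mulrC.
rewrite ge0_integralZ ?expR_ge0//.
  by rewrite muleC gam_expR.
by apply/measurable_EFinP; apply: measurableT_comp => //; exact: measurable_funM.
Qed.

Lemma gconv_expdot s t :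
  gconv s (expdot t) = (fun u => (expR ((\sum_(a <- s) dot t a ^+ 2) / 2))%:E * expdot t u).
Proof.
elim: s => [|a s IH] /=.
  by apply/funext => u; rewrite big_nil mul0r expR0 mul1e.
rewrite IH gstepZ ?expR_ge0//; last exact: ge0_mfun_expdot.
apply/funext => u; rewrite gstep_expdot muleA -EFinM -expRD big_cons.
by rewrite mulrDl [in RHS]addrC.
Qed.

(** A pointwise bound by a product of functions of the single normal variables
    integrates to the product of the one-dimensional integrals, one variable at
    a time. *)
Lemma gconv_prod_le (I : eqType) (s : seq I) (a : I -> V) (f : I -> R -> R) F u (C : R) :
  uniq s -> (0 <= C)%R -> ge0_mfun F ->
  (forall l, measurable_fun [set: R] (f l)) -> (forall l z, 0 <= f l z)%R ->
  (forall z : I -> R, F (u + \sum_(l <- s) z l *: a l)%R <= (C * \prod_(l <- s) f l (z l))%:E) ->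
  gconv [seq a l | l <- s] F u <= C%:E * \prod_(l <- s) \int[gam]_z (f l z)%:E.
Proof.
move=> us C0 nF mf f0; elim: s us u C C0 => [|l s IH] /= us u C C0 H.
  by have := H (fun=> 0%R); rewrite !big_nil addr0 mulr1 mule1.
move: us => /andP[ls us].
rewrite big_cons.
apply: (@le_trans _ _ (\int[gam]_z ((f l z)%:E * (C%:E * \prod_(l <- s) \int[gam]_z (f l z)%:E)))).
  apply: ge0_le_integral => //.
  - by move=> z _; case: (ge0_mfun_gconv [seq a l | l <- s] nF).
  - by apply: ge0_mfun_shift; exact: ge0_mfun_gconv.
  - by apply: emeasurable_funM; [apply/measurable_EFinP; exact: mf|exact: measurable_cst].
  move=> z _; rewrite muleA -EFinM; apply: IH => //; first by rewrite mulr_ge0.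
  move=> y; have := H (fun i => if i == l then z else y i).
  rewrite !big_cons eqxx addrA mulrA (mulrC C).
  rewrite (eq_big_seq (fun i => y i *: a i)); last first.
    by move=> i is_; case: eqP => // il; rewrite -il is_ in ls.
  rewrite (eq_big_seq (fun i => f i (y i))) => [//|i is_].
  by case: eqP => // il; rewrite -il is_ in ls.
rewrite ge0_integralZr//.
- by rewrite muleCA.
- by apply/measurable_EFinP; exact: mf.
- by move=> z _; rewrite lee_fin.
- rewrite mule_ge0//; apply: prode_ge0 => i _.
  by apply: integral_ge0 => z _; rewrite lee_fin.
Qed.

End gconv.

(** * Second-order expansion of powers *)

Section taylor.
Context {R : realType}.

(** A bound on the derivative that vanishes to order [k] at 1 gives a bound on
    the function that vanishes to order [k.+1]; three uses of it prove
    Taylor's inequality.  The threshold 1/2 keeps the negative powers of x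
    bounded. *)
Lemma mvt_bound (f df : R -> R) (M : R) k : 0 <= M ->
  (forall x : R, 2^-1 <= x -> is_derive x 1 f (df x)) -> f 1 = 0 ->
  (forall x, 2^-1 <= x -> `|df x| <= M * `|x - 1| ^+ k) ->
  forall x : R, 2^-1 <= x -> `|f x| <= M * `|x - 1| ^+ k.+1.
Proof.
move=> M0 fdf f1 dfM x x2.
have cont a b : 2^-1 <= a -> {within `[a, b], continuous f}.
  move=> a2; apply: derivable_within_continuous => y; rewrite in_itv/= => /andP[ay _].
  by have := fdf _ (le_trans a2 ay); case.
have [x1|x1|->] := ltgtP x 1; last by rewrite f1 normr0 mulr_ge0// exprn_ge0.
- have [|c] := MVT (df := df) x1 _ (cont _ _ x2).
    by move=> y; rewrite in_itv/= => /andP[/ltW xy _]; apply: fdf; exact: le_trans xy.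
  rewrite in_itv/= => /andP[xc c1]; rewrite f1 sub0r => fx.
  rewrite -normrN fx normrM exprSr mulrA -[`|x - 1|]normrN opprB ler_wpM2r//.
  apply: (le_trans (dfM c _)); first by rewrite (le_trans x2)// ltW.
  rewrite ler_wpM2l// lerXn2r// ?nnegrE// ltr0_norm ?subr_lt0// ger0_norm; last by lra.
  by lra.
- have h1 : (2^-1 <= 1 :> R) by lra.
  have [|c] := MVT (df := df) x1 _ (cont 1 x h1).
    by move=> y; rewrite in_itv/= => /andP[y1 _]; apply: fdf; lra.
  rewrite in_itv/= => /andP[xc c1]; rewrite f1 subr0 => ->.
  rewrite normrM exprSr mulrA ler_wpM2r//.
  apply: (le_trans (dfM c _)); first by lra.
  rewrite ler_wpM2l// lerXn2r// ?nnegrE// !gtr0_norm ?subr_gt0//.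
  by lra.
Qed.

(** On w >= 1/2 the third derivative q (q - 1) (q - 2) w^(q - 3) is at most 16
    in absolute value.  For w < 1/2 both sides are compared directly: the left
    one is at most 4 and |w - 1|^3 is at least 1/8. *)
Lemma powR_taylor (q w : R) : 0 < q < 1 -> 0 < w ->
  `|w `^ q - (1 + q * (w - 1) - q * (1 - q) / 2 * (w - 1) ^+ 2)| <= 32 * `|w - 1| ^+ 3.
Proof.
move=> /andP[q0 q1] w0.
have [w2|w2] := leP 2^-1 w; last first.
  have wq0 : 0 <= w `^ q by exact: powR_ge0.
  have wq1 : w `^ q <= 1.
    by rewrite -[leRHS](congr1 (@^~ q) (@powR1 R)); apply: ge0_ler_powR; rewrite ?nnegrE; lra.
  have h : 2^-1 ^+ 3 <= `|w - 1| ^+ 3.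
    by rewrite lerXn2r// ?nnegrE// ltr0_norm; lra.
  apply: (@le_trans _ _ (4 : R)); last by move: h; rewrite !exprS expr0 => h; lra.
  have qq : 0 <= q * (1 - q) / 2 <= 1 by nra.
  have s1 : 0 <= (w - 1) ^+ 2 <= 1 by rewrite sqr_ge0/= expr2; nra.
  have P : 0 <= q * (1 - q) / 2 * (w - 1) ^+ 2 <= 1.
    case/andP: qq => ? ?; case/andP: s1 => ? ?.
    by rewrite mulr_ge0//= mulr_ile1.
  rewrite ler_norml; apply/andP; split; nra.
pose D0 x : R := x `^ q - (1 + q * (x - 1) - q * (1 - q) / 2 * (x - 1) ^+ 2).
pose D1 x : R := q * x `^ (q - 1) - (q - q * (1 - q) * (x - 1)).
pose D2 x : R := q * ((q - 1) * x `^ (q - 2)) + q * (1 - q).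
pose D3 x : R := q * ((q - 1) * ((q - 2) * x `^ (q - 3))).
have dp (a x : R) : 2^-1 <= x -> is_derive x 1 (@powR R ^~ a) (a * x `^ (a - 1)).
  by move=> x2; apply: is_derive1_powR; lra.
have h2 x : 2^-1 <= x -> `|D2 x| <= 16 * `|x - 1| ^+ 1.
  move: x; apply: (@mvt_bound D2 D3 16 0%N).
  - by rewrite ler0n.
  - move=> y y2; have := dp (q - 2) y y2; rewrite (_ : q - 2 - 1 = q - 3) => [H|]; last by ring.
    rewrite /D2 /D3; apply: is_derive_eq; rewrite /GRing.scale/=; ring.
  - by rewrite /D2 powR1; ring.
  - move=> y y2; rewrite expr0 mulr1 /D3 !normrM.
    rewrite (ger0_norm (powR_ge0 _ _)) (gtr0_norm q0) !ltr0_norm; try lra.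
    have y0 : 0 < y by lra.
    have : y `^ (q - 3) <= 8.
      have [y1|y1] := leP 1 y.
        apply: (@le_trans _ _ (y `^ 0)); first by apply: ler_powR => //; lra.
        by rewrite powRr0; lra.
      apply: (@le_trans _ _ (y `^ (- 3%:R))).
        by apply: ger_powR; [apply/andP; split; lra|lra].
      rewrite powR_invn ?(ltW y0)// -exprVn.
      apply: (@le_trans _ _ (2 ^+ 3)); last by rewrite !exprS expr0; lra.
      by apply: lerXn2r; rewrite ?nnegrE ?invr_ge0 ?(ltW y0)// -[y^-1]div1r ler_pdivrMr//; lra.
    have := powR_ge0 y (q - 3).
    set z := y `^ _; move=> z0 z8.
    have e1 : 0 <= q * - (q - 1) <= 1 by nra.
    have e2 : 0 <= - (q - 2) * z <= 16 by nra.
    case/andP: e1 => e10 e11; case/andP: e2 => e20 e21.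
    rewrite mulrA; apply: (@le_trans _ _ (1 * 16)); last by lra.
    exact: ler_pM.
have h1 x : 2^-1 <= x -> `|D1 x| <= 16 * `|x - 1| ^+ 2.
  move: x; apply: (@mvt_bound D1 D2 16 1%N).
  - by rewrite ler0n.
  - move=> y y2; have := dp (q - 1) y y2; rewrite (_ : q - 1 - 1 = q - 2) => [H|]; last by ring.
    rewrite /D1 /D2; apply: is_derive_eq; rewrite /GRing.scale/=; ring.
  - by rewrite /D1 powR1; ring.
  - exact: h2.
have h0 x : 2^-1 <= x -> `|D0 x| <= 16 * `|x - 1| ^+ 3.
  move: x; apply: (@mvt_bound D0 D1 16 2%N).
  - by rewrite ler0n.
  - move=> y y2; have := dp q y y2 => H; rewrite /D0 /D1.
    by apply: is_derive_eq; rewrite /GRing.scale/=; field.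
  - by rewrite /D0 powR1; ring.
  - exact: h1.
apply: (le_trans (h0 _ w2)); rewrite ler_wpM2r ?exprn_ge0//; lra.
Qed.

End taylor.

(** * Exponential moments of Gaussian vectors *)

Section gaussE.
Context {R : realType} {N : nat}.
Local Notation V := 'rV[R]_N.
Implicit Types (f g : V -> R) (s : seq V).

Definition ge0_rfun f := measurable_fun [set: V] f /\ forall v, 0 <= f v.

(** Expectation of a function of the centered Gaussian vector with directions
    [s], whose covariance matrix is [cov s]. *)
Definition gaussE s f : \bar R := gconv s (EFin \o f) 0.

Lemma ge0_rfun_ge0_mfun f : ge0_rfun f -> ge0_mfun (EFin \o f).
Proof.
move=> [mf f0]; split; first exact/measurable_EFinP.
by move=> v; rewrite lee_fin.
Qed.

Lemma ge0_rfunD f g : ge0_rfun f -> ge0_rfun g -> ge0_rfun (fun v => f v + g v).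
Proof.
move=> [mf f0] [mg g0]; split; first exact: measurable_funD.
by move=> v; rewrite addr_ge0.
Qed.

Lemma ge0_rfunZ k f : 0 <= k -> ge0_rfun f -> ge0_rfun (fun v => k * f v).
Proof.
move=> k0 [mf f0]; split; first exact: measurable_funM.
by move=> v; rewrite mulr_ge0.
Qed.

Lemma ge0_rfunM f g : ge0_rfun f -> ge0_rfun g -> ge0_rfun (fun v => f v * g v).
Proof.
move=> [mf f0] [mg g0]; split; first exact: measurable_funM.
by move=> v; rewrite mulr_ge0.
Qed.

Lemma ge0_rfun_cst k : 0 <= k -> ge0_rfun (fun=> k).
Proof. by move=> k0; split. Qed.

Lemma ge0_rfun_sum (I : Type) (r : seq I) (F : I -> V -> R) :
  (forall i, ge0_rfun (F i)) -> ge0_rfun (fun v => \sum_(i <- r) F i v).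
Proof.
move=> rF; split; first by apply: measurable_sum => i; case: (rF i).
by move=> v; apply: sumr_ge0 => i _; case: (rF i).
Qed.

Lemma ge0_rfun_expR (k : R) i : ge0_rfun (fun v => expR (k * v 0 i)).
Proof.
split; last by move=> v; exact: expR_ge0.
apply: measurableT_comp => //; apply: measurable_funM => //.
exact: measurable_coord.
Qed.

Lemma gaussE_ge0 s f : ge0_rfun f -> (0 <= gaussE s f)%E.
Proof. by move=> rf; have [_] := ge0_mfun_gconv s (ge0_rfun_ge0_mfun rf); exact. Qed.

Lemma gaussED s f g : ge0_rfun f -> ge0_rfun g -> gaussE s (fun v => f v + g v) = (gaussE s f + gaussE s g)%E.
Proof.
move=> rf rg; rewrite /gaussE.
rewrite (_ : _ \o _ = fun v => ((EFin \o f) v + (EFin \o g) v)%E)//.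
by rewrite gconvD//; exact: ge0_rfun_ge0_mfun.
Qed.

Lemma gaussEZ s k f : 0 <= k -> ge0_rfun f -> gaussE s (fun v => k * f v) = (k%:E * gaussE s f)%E.
Proof.
move=> k0 rf; rewrite /gaussE.
rewrite (_ : _ \o _ = fun v => (k%:E * (EFin \o f) v)%E)//.
by rewrite gconvZ//; exact: ge0_rfun_ge0_mfun.
Qed.

Lemma gaussE_le s f g : ge0_rfun f -> ge0_rfun g -> (forall v, f v <= g v) -> (gaussE s f <= gaussE s g)%E.
Proof.
move=> rf rg fg; apply: gconv_le; do ?exact: ge0_rfun_ge0_mfun.
by move=> v; rewrite lee_fin.
Qed.

Lemma dot0 (t : 'I_N -> R) : dot t 0 = 0.
Proof. by rewrite /dot big1// => i _; rewrite mxE mulr0. Qed.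

Lemma gaussE_dot s t (r : R) : \sum_(a <- s) dot t a ^+ 2 = r ->
  gaussE s (fun v => expR (dot t v)) = (expR (r / 2))%:E.
Proof.
move=> <-; have -> : gaussE s (fun v => expR (dot t v)) = gconv s (expdot t) 0 by [].
by rewrite gconv_expdot /expdot dot0 expR0 mule1.
Qed.

Lemma gaussE_cst s k : 0 <= k -> gaussE s (fun=> k) = k%:E.
Proof.
move=> k0.
have t0 v : dot (fun=> 0) v = 0 by rewrite /dot big1// => i _; rewrite mul0r.
have -> : (fun=> k) = (fun v : V => k * expR (dot (fun=> 0) v)).
  by apply/funext => v; rewrite t0 expR0 mulr1.
rewrite gaussEZ//.
  rewrite (@gaussE_dot _ _ 0) ?mul0r ?expR0 ?mule1//.
  by apply: big1 => a _; rewrite t0 expr0n.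
split; last by move=> v; exact: expR_ge0.
by apply: measurableT_comp => //; exact: measurable_dot.
Qed.

Lemma gaussE_sum s (I : Type) (r : seq I) (F : I -> V -> R) :
  (forall i, ge0_rfun (F i)) ->
  gaussE s (fun v => \sum_(i <- r) F i v) = (\sum_(i <- r) gaussE s (F i))%E.
Proof.
move=> rF; elim: r => [|i r IH].
  rewrite big_nil (_ : (fun=> _) = (fun=> 0)) ?gaussE_cst//.
  by apply/funext => v; rewrite big_nil.
rewrite big_cons -IH -gaussED//; last exact: ge0_rfun_sum.
by congr gaussE; apply/funext => v; rewrite big_cons.
Qed.

Definition cov s i j : R := \sum_(a <- s) a 0 i * a 0 j.

Lemma gaussE_expR s (k : R) i :
  gaussE s (fun v : V => expR (k * v 0 i)) = (expR (k ^+ 2 * cov s i i / 2))%:E.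
Proof.
pose t j : R := if j == i then k else 0.
have tE v : dot t v = k * v 0 i.
  rewrite /dot (bigD1 i)//= /t eqxx big1 ?addr0// => j /negPf ->.
  by rewrite mul0r.
have -> : (fun v : V => expR (k * v 0 i)) = (fun v : V => expR (dot t v)).
  by apply/funext => v; rewrite tE.
apply: gaussE_dot; rewrite /cov big_distrr; apply: eq_bigr => a _ /=.
by rewrite tE exprMn expr2.
Qed.

Lemma gaussE_expR2 s (k : R) i j :
  gaussE s (fun v : V => expR (k * v 0 i) * expR (k * v 0 j)) =
  (expR (k ^+ 2 * (cov s i i + cov s j j + 2 * cov s i j) / 2))%:E.
Proof.
pose t l : R := (if l == i then k else 0) + (if l == j then k else 0).
have tE v : dot t v = k * (v 0 i + v 0 j).
  rewrite /dot /t; under eq_bigr do rewrite mulrDl.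
  rewrite big_split /= (bigD1 i)//= eqxx big1 ?addr0; last first.
    by move=> l /negPf ->; rewrite mul0r.
  rewrite (bigD1 j)//= eqxx big1 ?addr0 ?mulrDr// => l /negPf ->.
  by rewrite mul0r.
have -> : (fun v : V => expR (k * v 0 i) * expR (k * v 0 j)) = (fun v : V => expR (dot t v)).
  by apply/funext => v; rewrite tE mulrDr expRD.
apply: gaussE_dot; rewrite /cov [2 * _]big_distrr -!big_split big_distrr.
by apply: eq_bigr => a _ /=; rewrite tE; ring.
Qed.

(** From (1 - x) e^x <= 1. *)
Lemma expR_le2 (x : R) : x <= 2^-1 -> expR x <= 1 + x + 2 * x ^+ 2.
Proof.
move=> x2.
have h : (1 - x) * expR x <= 1.
  have := expR_ge1Dx (- x); rewrite expRN => H.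
  by rewrite -ler_pdivlMr ?expR_gt0// div1r.
have e0 := expR_gt0 x.
have x1 : 0 < 1 - x by lra.
apply: (@le_trans _ _ (1 - x)^-1); first by rewrite -[leRHS]div1r ler_pdivlMr// mulrC.
rewrite -[leLHS]div1r ler_pdivrMr//.
have := sqr_ge0 x; rewrite !expr2 => ?; nra.
Qed.

(** Expanding the square, the terms of order zero in the variance cancel.  As
    [gaussE] is additive on nonnegative functions only, the negative term of the
    expansion is first moved to the other side. *)
Lemma gaussE_sq s (k : R) i : k ^+ 2 * cov s i i <= 16^-1 ->
  (gaussE s (fun v : V => (expR (k * v 0 i) - 1) ^+ 2)%R <= (2 * (k ^+ 2 * cov s i i))%:E)%E.
Proof.
set t := _ * cov s i i => t1.
have t0 : 0 <= t.
  by rewrite mulr_ge0 ?sqr_ge0//; apply: sumr_ge0 => a _; rewrite -expr2 sqr_ge0.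
have r1 : ge0_rfun (fun v => (expR (k * v 0 i) - 1) ^+ 2).
  split; last by move=> v; rewrite sqr_ge0.
  by apply: measurable_funX; apply: measurable_funB => //; case: (ge0_rfun_expR k i).
have := @gaussED s _ _ r1 (ge0_rfunZ (ler0n R 2) (ge0_rfun_expR k i)).
have -> : (fun v : V => (expR (k * v 0 i) - 1) ^+ 2 + 2 * expR (k * v 0 i)) =
   (fun v => expR ((2 * k) * v 0 i) + 1).
  apply/funext => v; rewrite (_ : 2 * k * v 0 i = k * v 0 i + k * v 0 i); last by ring.
  by rewrite expRD; ring.
rewrite gaussED; [|exact: ge0_rfun_expR|exact: ge0_rfun_cst].
rewrite gaussEZ//; last exact: ge0_rfun_expR.
rewrite !gaussE_expR gaussE_cst//.
have := gaussE_ge0 s r1; case: (gaussE s _) => [x| |]//= _.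
rewrite -!EFinM -!EFinD => -[] H; rewrite lee_fin.
have h1 : expR ((2 * k) ^+ 2 * cov s i i / 2) <= 1 + (2 * t) + 2 * (2 * t) ^+ 2.
  rewrite (_ : (2 * k) ^+ 2 * cov s i i / 2 = 2 * t); last by rewrite /t; field.
  by apply: expR_le2; lra.
have h2 := expR_ge1Dx (t / 2).
move: H h1; rewrite -/t => H h1; rewrite !expr2 in h1; nra.
Qed.

(** In the expansion (e^y - 1)^4 = e^(4y) - 4 e^(3y) + 6 e^(2y) - 4 e^y + 1 the
    first-order terms in the variance t cancel as well (8 - 18 + 12 - 2 = 0),
    so that only t^2 remains.  The constant is 128 from e^(4y) plus 48 from
    6 e^(2y); the two negative terms need only e^x >= 1 + x. *)
Lemma gaussE_quart s (k : R) i : k ^+ 2 * cov s i i <= 16^-1 ->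
  (gaussE s (fun v : V => (expR (k * v 0 i) - 1) ^+ 4)%R <= (176 * (k ^+ 2 * cov s i i) ^+ 2)%:E)%E.
Proof.
set t := _ * cov s i i => t1.
have t0 : 0 <= t.
  by rewrite mulr_ge0 ?sqr_ge0//; apply: sumr_ge0 => a _; rewrite -expr2 sqr_ge0.
have r1 : ge0_rfun (fun v => (expR (k * v 0 i) - 1) ^+ 4).
  split; last by move=> v; rewrite exprn_even_ge0.
  by apply: measurable_funX; apply: measurable_funB => //; case: (ge0_rfun_expR k i).
have r2 : ge0_rfun (fun v : V => 4 * expR ((3 * k) * v 0 i) + 4 * expR (k * v 0 i)).
  by apply: ge0_rfunD; apply: ge0_rfunZ => //; exact: ge0_rfun_expR.
have := @gaussED s _ _ r1 r2.
have -> : (fun v : V => (expR (k * v 0 i) - 1) ^+ 4 +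
    (4 * expR ((3 * k) * v 0 i) + 4 * expR (k * v 0 i))) =
   (fun v => expR ((4 * k) * v 0 i) + (6 * expR ((2 * k) * v 0 i) + 1)).
  apply/funext => v; set y := k * v 0 i.
  rewrite (_ : 3 * k * v 0 i = y + (y + y)); last by rewrite /y; ring.
  rewrite (_ : 4 * k * v 0 i = (y + y) + (y + y)); last by rewrite /y; ring.
  rewrite (_ : 2 * k * v 0 i = (y + y)); last by rewrite /y; ring.
  by rewrite !expRD; ring.
rewrite !gaussED; do ?[exact: ge0_rfun_expR | exact: ge0_rfun_cst | (apply: ge0_rfunZ => //; exact: ge0_rfun_expR)
  | (apply: ge0_rfunD; [apply: ge0_rfunZ => //; exact: ge0_rfun_expR|exact: ge0_rfun_cst])].
rewrite !gaussEZ//; do ?exact: ge0_rfun_expR.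
rewrite !gaussE_expR gaussE_cst//.
have := gaussE_ge0 s r1; case: (gaussE s _) => [x| |]//= _.
rewrite -!EFinM -!EFinD => -[] H; rewrite lee_fin.
have h1 : expR ((4 * k) ^+ 2 * cov s i i / 2) <= 1 + (8 * t) + 2 * (8 * t) ^+ 2.
  rewrite (_ : (4 * k) ^+ 2 * cov s i i / 2 = 8 * t); last by rewrite /t; field.
  by apply: expR_le2; lra.
have h2 : expR ((2 * k) ^+ 2 * cov s i i / 2) <= 1 + (2 * t) + 2 * (2 * t) ^+ 2.
  rewrite (_ : (2 * k) ^+ 2 * cov s i i / 2 = 2 * t); last by rewrite /t; field.
  by apply: expR_le2; lra.
have h3 := expR_ge1Dx (t / 2).
have h4 : 1 + 9 / 2 * t <= expR ((3 * k) ^+ 2 * cov s i i / 2).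
  rewrite (_ : (3 * k) ^+ 2 * cov s i i / 2 = 9 / 2 * t); last by rewrite /t; field.
  exact: expR_ge1Dx.
move: H h1 h2; rewrite -/t => H h1 h2; rewrite !expr2 in h1 h2 *.
have := sqr_ge0 t; rewrite expr2; nra.
Qed.

End gaussE.

(** * Powers of exponential sums under a small Gaussian perturbation *)

Lemma ge0_le_fin (R : realType) (e : \bar R) (r : R) :
  (0 <= e)%E -> (e <= r%:E)%E -> exists x, e = x%:E.
Proof. by case: e => [x| |]//= _ _; exists x. Qed.

Section step.
Context {R : realType} {N : nat}.
Local Notation V := 'rV[R]_N.
Variables (p : 'I_N -> R) (theta : R).
Hypotheses (p0 : forall i, 0 <= p i) (p1 : \sum_i p i = 1).

Lemma jensen_sq (x : 'I_N -> R) : (\sum_i p i * x i) ^+ 2 <= \sum_i p i * x i ^+ 2.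
Proof.
have E m : \sum_i p i * (x i - m) ^+ 2 =
    \sum_i p i * x i ^+ 2 - 2 * m * (\sum_i p i * x i) + m ^+ 2 * \sum_i p i.
  rewrite !mulr_sumr -sumrB -big_split/=; apply: eq_bigr => i _; ring.
have : 0 <= \sum_i p i * (x i - \sum_i p i * x i) ^+ 2.
  by apply: sumr_ge0 => i _; rewrite mulr_ge0// sqr_ge0.
by rewrite E p1 !expr2; lra.
Qed.

(** The ratio of an exponential sum after and before the shift [v], when [p]
    are its normalized summands. *)
Definition tilt (v : V) : R := \sum_i p i * expR (theta * v 0 i).

(** Averaged even powers of the deviations dominate those of [tilt v - 1] by
    Jensen's inequality, and unlike them have explicit Gaussian means. *)
Definition dev2 (v : V) : R := \sum_i p i * (expR (theta * v 0 i) - 1) ^+ 2.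
Definition dev4 (v : V) : R := \sum_i p i * (expR (theta * v 0 i) - 1) ^+ 4.

Lemma tilt_gt0 v : 0 < tilt v.
Proof.
have [i pi0] : exists i, 0 < p i.
  apply: contrapT => /forallNP H; move: p1; rewrite big1 => [/eqP|i _].
    by rewrite eq_sym oner_eq0.
  by apply/eqP; rewrite eq_le p0 andbT leNgt; apply/negP/H.
rewrite /tilt (bigD1 i)//= ltr_pwDl ?mulr_gt0 ?expR_gt0//.
by apply: sumr_ge0 => j _; rewrite mulr_ge0// expR_ge0.
Qed.

Lemma tilt_dev2 v : (tilt v - 1) ^+ 2 <= dev2 v.
Proof.
have -> : tilt v - 1 = \sum_i p i * (expR (theta * v 0 i) - 1).
  rewrite /tilt -[in LHS]p1 -sumrN -big_split; apply: eq_bigr => i _ /=; ring.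
exact: jensen_sq.
Qed.

Lemma tilt_dev4 v : (tilt v - 1) ^+ 4 <= dev4 v.
Proof.
have m20 : 0 <= dev2 v by apply: le_trans (tilt_dev2 v); exact: sqr_ge0.
apply: (@le_trans _ _ (dev2 v ^+ 2)).
  by rewrite (exprM _ 2 2) lerXn2r ?nnegrE ?sqr_ge0// tilt_dev2.
apply: (le_trans (jensen_sq _)); rewrite /dev4 le_eqVlt; apply/orP; left; apply/eqP.
by apply: eq_bigr => i _; rewrite -exprM.
Qed.

Variables (q delta : R).
Hypotheses (q01 : 0 < q < 1) (d0 : 0 < delta).
Let kap := q * (1 - q) / 2.
Let rem v := 16 * (delta * dev2 v + delta^-1 * dev4 v).

(** 2 |x|^3 <= delta x^2 + x^4 / delta trades the cubic Taylor remainder, whose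
    mean is not explicit, for even moments.  At scale delta the variance is of
    order delta^2, so both terms have mean of order delta^3. *)
Lemma tilt_cube v : 32 * `|tilt v - 1| ^+ 3 <= rem v.
Proof.
have := tilt_dev2 v; have := tilt_dev4 v; rewrite /rem.
set x := `|tilt v - 1|.
have x0 : 0 <= x by exact: normr_ge0.
have -> : (tilt v - 1) ^+ 4 = x ^+ 4 by rewrite /x -normrX ger0_norm// exprn_even_ge0.
have -> : (tilt v - 1) ^+ 2 = x ^+ 2 by rewrite /x -normrX ger0_norm// sqr_ge0.
move=> h4 h2.
apply: (@le_trans _ _ (16 * (delta * x ^+ 2 + delta^-1 * x ^+ 4))); last first.
  by rewrite ler_wpM2l// lerD// ler_wpM2l// ?invr_ge0 ltW.
have : 0 <= delta^-1 * (x * (delta - x)) ^+ 2 by rewrite mulr_ge0 ?invr_ge0 ?(ltW d0)// sqr_ge0.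
have -> : delta^-1 * (x * (delta - x)) ^+ 2 = delta * x ^+ 2 + delta^-1 * x ^+ 4 - 2 * x ^+ 3.
  by field; rewrite gt_eqF.
by lra.
Qed.

(** Keeps the mean of a power of [tilt] away from 0, so that an additive error
    can be turned into a multiplicative one. *)
Lemma powR_ge34 (w : R) : 0 < w -> 3 / 4 - (w - 1) ^+ 2 <= w `^ q.
Proof.
move=> w0; case/andP: q01 => q0 q1; have := sqr_ge0 (w - 1 + 2^-1); rewrite !expr2 => h.
have [w1|w1] := leP 1 w.
  apply: (@le_trans _ _ (w `^ 0)); last by apply: ler_powR => //; exact: ltW.
  by rewrite powRr0; have := sqr_ge0 (w - 1); rewrite expr2; lra.
apply: (@le_trans _ _ w); first by nra.
by apply: ger1_powR; [rewrite w0 ltW|exact: ltW].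
Qed.

Variables (s : seq V) (M : R).
Hypotheses (M0 : 0 <= M) (dM : delta ^+ 2 * M <= 16^-1).
Hypothesis sM : forall i, theta ^+ 2 * cov s i i <= delta ^+ 2 * M.

Lemma ge0_rfun_tilt : ge0_rfun tilt.
Proof. by apply: ge0_rfun_sum => i; apply: ge0_rfunZ => //; exact: ge0_rfun_expR. Qed.

Lemma ge0_rfun_pow k i : ~~ odd k -> ge0_rfun (fun v : V => (expR (theta * v 0 i) - 1) ^+ k).
Proof.
move=> ek; split; last by move=> v; rewrite exprn_even_ge0.
by apply: measurable_funX; apply: measurable_funB => //; case: (ge0_rfun_expR theta i).
Qed.

Lemma ge0_rfun_dev2 : ge0_rfun dev2.
Proof. by apply: ge0_rfun_sum => i; apply: ge0_rfunZ => //; exact: ge0_rfun_pow. Qed.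

Lemma ge0_rfun_dev4 : ge0_rfun dev4.
Proof. by apply: ge0_rfun_sum => i; apply: ge0_rfunZ => //; exact: ge0_rfun_pow. Qed.

Lemma ge0_rfun_tiltq : ge0_rfun (fun v => tilt v `^ q).
Proof.
split; last by move=> v; exact: powR_ge0.
by apply: (measurableT_comp (measurable_powR q)); case: ge0_rfun_tilt.
Qed.

Definition tilt_mean (s : seq V) := \sum_i p i * expR (theta ^+ 2 * cov s i i / 2).
Definition tilt_sqmean (s : seq V) := \sum_i \sum_j p i * p j *
  expR (theta ^+ 2 * (cov s i i + cov s j j + 2 * cov s i j) / 2).

Lemma gaussE_tilt : gaussE s tilt = (tilt_mean s)%:E.
Proof.
rewrite /tilt gaussE_sum; last by move=> i; apply: ge0_rfunZ => //; exact: ge0_rfun_expR.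
rewrite /tilt_mean -sumEFin; apply: eq_bigr => i _.
by rewrite gaussEZ//; [rewrite gaussE_expR|exact: ge0_rfun_expR].
Qed.

Lemma gaussE_tilt2 : gaussE s (fun v => tilt v * tilt v) = (tilt_sqmean s)%:E.
Proof.
have -> : (fun v => tilt v * tilt v) = (fun v => \sum_i \sum_j
    (p i * p j) * (expR (theta * v 0 i) * expR (theta * v 0 j))).
  apply/funext => v; rewrite /tilt big_distrl; apply: eq_bigr => i _ /=.
  by rewrite big_distrr; apply: eq_bigr => j _ /=; rewrite mulrACA.
have r2 i j : ge0_rfun (fun v : V => (p i * p j) * (expR (theta * v 0 i) * expR (theta * v 0 j))).
  by apply: ge0_rfunZ; [rewrite mulr_ge0|apply: ge0_rfunM; exact: ge0_rfun_expR].
rewrite gaussE_sum; last by move=> i; apply: ge0_rfun_sum => j; exact: r2.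
rewrite /tilt_sqmean -sumEFin; apply: eq_bigr => i _.
rewrite gaussE_sum; last by move=> j; exact: r2.
rewrite -sumEFin; apply: eq_bigr => j _.
rewrite gaussEZ; [|by rewrite mulr_ge0|by apply: ge0_rfunM; exact: ge0_rfun_expR].
by rewrite gaussE_expR2.
Qed.

Lemma sum_p_le (f : 'I_N -> \bar R) (b : R) : (forall i, f i <= b%:E)%E ->
  (\sum_i (p i)%:E * f i <= b%:E)%E.
Proof.
move=> fb; apply: (@le_trans _ _ (\sum_i (p i * b)%:E)%E).
  by apply: lee_sum => i _; rewrite EFinM lee_wpmul2l// lee_fin.
by rewrite sumEFin -mulr_suml p1 mul1r.
Qed.

Lemma gaussE_dev2 : (gaussE s dev2 <= (2 * (delta ^+ 2 * M))%:E)%E.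
Proof.
rewrite /dev2 gaussE_sum; last by move=> i; apply: ge0_rfunZ => //; exact: ge0_rfun_pow.
rewrite (eq_bigr (fun i => ((p i)%:E * gaussE s (fun v : V => (expR (theta * v 0 i) - 1) ^+ 2)%R)%E)); last by move=> i _; rewrite gaussEZ//; exact: ge0_rfun_pow.
apply: sum_p_le => i; apply: (le_trans (gaussE_sq _)); first exact: (le_trans (sM i)).
by rewrite lee_fin ler_wpM2l.
Qed.

Lemma gaussE_dev4 : (gaussE s dev4 <= (176 * (delta ^+ 2 * M) ^+ 2)%:E)%E.
Proof.
rewrite /dev4 gaussE_sum; last by move=> i; apply: ge0_rfunZ => //; exact: ge0_rfun_pow.
rewrite (eq_bigr (fun i => ((p i)%:E * gaussE s (fun v : V => (expR (theta * v 0 i) - 1) ^+ 4)%R)%E)); last by move=> i _; rewrite gaussEZ//; exact: ge0_rfun_pow.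
apply: sum_p_le => i; apply: (le_trans (gaussE_quart _)); first exact: (le_trans (sM i)).
rewrite lee_fin ler_wpM2l//; apply: lerXn2r; rewrite ?nnegrE//; last first.
  by apply: mulr_ge0; [exact: sqr_ge0|exact: M0].
apply: mulr_ge0; first exact: sqr_ge0.
by apply: sumr_ge0 => a _; rewrite -expr2 sqr_ge0.
Qed.

Lemma ge0_rfun_rem : ge0_rfun rem.
Proof.
apply: ge0_rfunZ => //; apply: ge0_rfunD; apply: ge0_rfunZ; rewrite ?invr_ge0 ?(ltW d0)//.
  exact: ge0_rfun_dev2.
exact: ge0_rfun_dev4.
Qed.

Lemma gaussE_rem : (gaussE s rem <= (delta ^+ 3 * (32 * M + 2816 * M ^+ 2))%:E)%E.
Proof.
have di : 0 <= delta^-1 by rewrite invr_ge0 ltW.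
rewrite /rem gaussEZ//; last first.
  by apply: ge0_rfunD; apply: ge0_rfunZ => //; [exact: ltW|exact: ge0_rfun_dev2|exact: ge0_rfun_dev4].
rewrite gaussED; last 2 first.
- by apply: ge0_rfunZ; [exact: ltW|exact: ge0_rfun_dev2].
- by apply: ge0_rfunZ; [|exact: ge0_rfun_dev4].
rewrite !gaussEZ ?(ltW d0)//; [|exact: ge0_rfun_dev4|exact: ge0_rfun_dev2].
apply: (@le_trans _ _ (16%:E * (delta%:E * (2 * (delta ^+ 2 * M))%:E + delta^-1%:E * (176 * (delta ^+ 2 * M) ^+ 2)%:E))%E).
  rewrite lee_wpmul2l ?lee_fin// leeD// lee_wpmul2l ?lee_fin ?(ltW d0)//.
    exact: gaussE_dev2.
  exact: gaussE_dev4.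
have -> : (16%:E * (delta%:E * (2 * (delta ^+ 2 * M))%:E + delta^-1%:E * (176 * (delta ^+ 2 * M) ^+ 2)%:E))%E =
  (16 * (delta * (2 * (delta ^+ 2 * M)) + delta^-1 * (176 * (delta ^+ 2 * M) ^+ 2)))%:E by [].
rewrite lee_fin le_eqVlt; apply/orP; left; apply/eqP.
by field; rewrite gt_eqF.
Qed.

(** Taylor expansion of the mean of [tilt v `^ q] at scale delta, with two-sided
    error of order delta^3.  With kap = q (1 - q) / 2 the Taylor polynomial
    1 + q (T - 1) - kap (T - 1)^2 equals
    (1 - q) + (q + 2 kap) T - kap T^2 - kap; the two negative terms stand on the
    side of x because the Gaussian expectation is only additive on nonnegative
    functions. *)
Lemma gaussE_powR : exists x : R, [/\ gaussE s (fun v => tilt v `^ q) = x%:E,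
  x + kap * tilt_sqmean s + kap <= (1 - q) + (q + 2 * kap) * tilt_mean s + delta ^+ 3 * (32 * M + 2816 * M ^+ 2),
  (1 - q) + (q + 2 * kap) * tilt_mean s <= x + kap * tilt_sqmean s + kap + delta ^+ 3 * (32 * M + 2816 * M ^+ 2) &
  2^-1 <= x].
Proof.
have [q0 q1] := andP q01.
have k0 : 0 <= kap by rewrite /kap divr_ge0// mulr_ge0 ?ltW// subr_gt0.
have rq := ge0_rfun_tiltq; have rt := ge0_rfun_tilt; have rr := ge0_rfun_rem.
have rtt : ge0_rfun (fun v => tilt v * tilt v) by exact: ge0_rfunM.
have qk : 0 <= q + 2 * kap by rewrite addr_ge0 ?(ltW q0)// mulr_ge0.
pose L v := tilt v `^ q + (kap * (tilt v * tilt v) + kap).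
pose U v := (1 - q) + (q + 2 * kap) * tilt v.
have rkk : ge0_rfun (fun v => kap * (tilt v * tilt v) + kap).
  by apply: ge0_rfunD; [exact: ge0_rfunZ|exact: ge0_rfun_cst].
have rL : ge0_rfun L by exact: ge0_rfunD.
have rU : ge0_rfun U by apply: ge0_rfunD; [by apply: ge0_rfun_cst; rewrite subr_ge0 ltW|exact: ge0_rfunZ].
have LE : gaussE s L = (gaussE s (fun v => tilt v `^ q)%R + (kap * tilt_sqmean s + kap)%:E)%E.
  rewrite gaussED// gaussED//; do ?[exact: ge0_rfunZ|exact: ge0_rfun_cst].
  by rewrite gaussEZ// gaussE_cst// gaussE_tilt2 -EFinM EFinD.
have UE : gaussE s U = ((1 - q) + (q + 2 * kap) * tilt_mean s)%:E.
  rewrite gaussED; do ?[by apply: ge0_rfun_cst; rewrite subr_ge0 ltW|exact: ge0_rfunZ].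
  by rewrite gaussEZ// gaussE_cst ?subr_ge0 1?ltW// gaussE_tilt -EFinM EFinD.
have tay v : `|tilt v `^ q - (1 + q * (tilt v - 1) - kap * (tilt v - 1) ^+ 2)| <= rem v.
  exact: le_trans (powR_taylor q01 (tilt_gt0 v)) (tilt_cube v).
have HU : (gaussE s L <= gaussE s U + gaussE s rem)%E.
  rewrite -gaussED//; apply: gaussE_le => //; first exact: ge0_rfunD.
  move=> v; have := tay v; rewrite ler_norml /L /U !expr2 => /andP[_]; lra.
have HL : (gaussE s U <= gaussE s L + gaussE s rem)%E.
  rewrite -gaussED//; apply: gaussE_le => //; first exact: ge0_rfunD.
  move=> v; have := tay v; rewrite ler_norml /L /U !expr2 => /andP[+ _]; lra.
have HH : ((3 / 4)%:E <= gaussE s (fun v => tilt v `^ q)%R + gaussE s dev2)%E.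
  rewrite -(@gaussE_cst _ _ s (3 / 4))// -gaussED//; last exact: ge0_rfun_dev2.
  apply: gaussE_le; [exact: ge0_rfun_cst|by apply: ge0_rfunD => //; exact: ge0_rfun_dev2|].
  move=> v; have := powR_ge34 (tilt_gt0 v); have := tilt_dev2 v; lra.
have x0 := gaussE_ge0 s rq.
have r0 := gaussE_ge0 s rr.
have [r rE] := ge0_le_fin r0 gaussE_rem.
have [y yE] := ge0_le_fin (gaussE_ge0 s ge0_rfun_dev2) gaussE_dev2.
have [x xE] : exists x, gaussE s (fun v => tilt v `^ q) = x%:E.
  move: HU x0; rewrite LE UE rE.
  by case: (gaussE s _) => [x| |]//; exists x.
have := gaussE_rem; have := gaussE_dev2; move: HU HL HH.
rewrite LE UE rE yE xE -!EFinD !lee_fin => HU HL HH h2 h; exists x; split => //.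
- lra.
- lra.
- by move: dM; lra.
Qed.

End step.

(** * A Slepian-type comparison for powers of exponential sums *)

Section slepian.
Context {R : realType} {N : nat}.
Local Notation V := 'rV[R]_N.
Variables (theta q : R).
Hypotheses (q01 : 0 < q < 1) (N0 : (0 < N)%N).

(** For theta q = c, [softmax] lies between exp (c max v) and N^q exp (c max v)
    and is smooth, which makes it a substitute for the exponential of the
    maximum. *)
Definition sumexp (v : V) : R := \sum_i expR (theta * v 0 i).
Definition softmax (v : V) : \bar R := (sumexp v `^ q)%:E.

Lemma sumexp_gt0 v : 0 < sumexp v.
Proof.
rewrite /sumexp (bigD1 (Ordinal N0))//= ltr_pwDl ?expR_gt0//.
by apply: sumr_ge0 => i _; exact: expR_ge0.
Qed.

Lemma ge0_mfun_softmax : ge0_mfun softmax.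
Proof.
split; last by move=> v; rewrite lee_fin powR_ge0.
apply/measurable_EFinP; apply: (measurableT_comp (measurable_powR q)).
by have [] := ge0_rfun_sum (index_enum 'I_N) (ge0_rfun_expR theta).
Qed.

Definition weight (u : V) i : R := expR (theta * u 0 i) / sumexp u.

Lemma weight_ge0 u i : 0 <= weight u i.
Proof. by rewrite divr_ge0 ?expR_ge0// ltW// sumexp_gt0. Qed.

Lemma weight_sum1 u : \sum_i weight u i = 1.
Proof. by rewrite -mulr_suml divff// gt_eqF// sumexp_gt0. Qed.

Lemma softmaxD u v : softmax (u + v) =
  ((sumexp u `^ q)%:E * (tilt (weight u) theta v `^ q)%:E)%E.
Proof.
rewrite /softmax -EFinM -powRM ?ltW ?sumexp_gt0//; last first.
  by apply: tilt_gt0; [exact: weight_ge0|exact: weight_sum1].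
congr (_ `^ q)%:E; rewrite /tilt mulr_sumr; apply: eq_bigr => i _.
by rewrite mxE mulrDr expRD /weight mulrA mulrCA divff ?mulr1// gt_eqF// sumexp_gt0.
Qed.

(** Factoring out the value at u turns an average around u into an average
    around 0 of a power of [tilt], with the weights of a softmax at u. *)
Lemma gconv_softmax s u : gconv s softmax u =
  ((sumexp u `^ q)%:E * gaussE s (fun v => tilt (weight u) theta v `^ q)%R)%E.
Proof.
pose G w := (tilt (weight u) theta w `^ q)%:E.
have nG : ge0_mfun G.
  have [mt t0] := ge0_rfun_tiltq theta (weight_ge0 u) q.
  by split; [exact/measurable_EFinP|move=> v; rewrite lee_fin; exact: t0].
have shift : gconv s (fun w => softmax (u + w)) 0 = gconv s softmax u.
  exact (etrans (gconv_shift s softmax u 0) (congr1 (gconv s softmax) (addr0 u))).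
have GE : (fun w => softmax (u + w)) = fun w => ((sumexp u `^ q)%:E * G w)%E.
  apply/funext => w; exact (softmaxD u w).
rewrite -shift GE.
exact (congr1 (@^~ 0) (gconvZ s (powR_ge0 (sumexp u) q) nG)).
Qed.

Lemma cov_scale (d : R) (s : seq V) i j :
  cov [seq d *: a | a <- s] i j = d ^+ 2 * cov s i j.
Proof.
rewrite /cov big_map mulr_sumr; apply: eq_bigr => a _.
by rewrite !mxE; ring.
Qed.

Variables (sA sB : seq V).
Hypotheses (covd : forall i, cov sA i i = cov sB i i)
           (covle : forall i j, cov sB i j <= cov sA i j).

Let M : R := theta ^+ 2 * \sum_i cov sA i i.

Let covd0 (s : seq V) i : 0 <= cov s i i.
Proof. by apply: sumr_ge0 => a _; rewrite -expr2 sqr_ge0. Qed.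

Let M0 : 0 <= M.
Proof. by apply: mulr_ge0; [exact: sqr_ge0|apply: sumr_ge0 => i _; exact: covd0]. Qed.

Let K : R := 32 * M + 2816 * M ^+ 2.

Let K0 : 0 <= K.
Proof.
apply: addr_ge0; apply: mulr_ge0.
- exact: ler0n.
- exact: M0.
- exact: ler0n.
- exact: sqr_ge0.
Qed.

Let covM i : theta ^+ 2 * cov sA i i <= M.
Proof.
apply: ler_wpM2l; first exact: sqr_ge0.
by rewrite (bigD1 i)//= lerDl; apply: sumr_ge0 => j _; exact: covd0.
Qed.

Opaque K.

(** Comparison at one small scale.  The first moments of [tilt] agree because
    the variances do; the second moments are ordered as the covariances and
    enter with a negative sign.  The additive error becomes a factor because the
    mean of the power of [tilt] is at least 1/2. *)
Lemma softmax_step (d : R) : 0 < d -> d ^+ 2 * M <= 16^-1 ->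
  forall u, (gconv [seq d *: a | a <- sA] softmax u <=
             (1 + 4 * K * d ^+ 3)%:E * gconv [seq d *: a | a <- sB] softmax u)%E.
Proof.
move=> d0 dM u; rewrite !gconv_softmax muleCA.
rewrite lee_wpmul2l ?lee_fin ?powR_ge0//.
have [q0 q1] := andP q01.
have sM (s : seq V) : (forall i, cov s i i = cov sA i i) ->
    forall i, theta ^+ 2 * cov [seq d *: a | a <- s] i i <= d ^+ 2 * M.
  move=> H i; rewrite cov_scale H mulrCA; apply: ler_wpM2l; first exact: sqr_ge0.
  exact: covM.
have [x [-> hx _ _]] := gaussE_powR (weight_ge0 u) (weight_sum1 u) q01 d0 M0 dM (sM sA (fun=> erefl)).
have [y [-> _ hy y2]] := gaussE_powR (weight_ge0 u) (weight_sum1 u) q01 d0 M0 dM (sM sB (fun i => esym (covd i))).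
have W1E : tilt_mean (weight u) theta [seq d *: a | a <- sA] = tilt_mean (weight u) theta [seq d *: a | a <- sB].
  by apply: eq_bigr => i _; rewrite !cov_scale covd.
have W2le : tilt_sqmean (weight u) theta [seq d *: a | a <- sB] <= tilt_sqmean (weight u) theta [seq d *: a | a <- sA].
  apply: ler_sum => i _; apply: ler_sum => j _.
  apply: ler_wpM2l; first by rewrite mulr_ge0// weight_ge0.
  rewrite ler_expR ler_wpM2r// ?invr_ge0//; apply: ler_wpM2l; first exact: sqr_ge0.
  rewrite !cov_scale !covd lerD2l ler_wpM2l//; apply: ler_wpM2l => //; exact: sqr_ge0.
rewrite -EFinM lee_fin.
move: hx hy; rewrite W1E; set w1 := tilt_mean _ _ _; set wa := tilt_sqmean _ _ [seq _ | _ <- sA].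
set wb := tilt_sqmean _ _ _; set k := q * (1 - q) / 2; rewrite -/K; set rho := d ^+ 3 * K => hx hy.
have k0 : 0 <= k by rewrite /k divr_ge0// mulr_ge0 ?ltW// subr_gt0.
have kw : k * wb <= k * wa by rewrite ler_wpM2l.
have rho0 : 0 <= rho.
  by apply: mulr_ge0; [apply: exprn_ge0; exact: ltW|exact: K0].
have CE : 4 * K * d ^+ 3 = 4 * rho by rewrite /rho -mulrA (mulrC K).
(* wa >= wb gives x <= y + 2 rho, and 2 rho <= 4 rho y since y >= 1/2. *)
rewrite CE; have : rho * 2^-1 <= rho * y by rewrite ler_wpM2l.
nra.
Qed.

Let h : R := (Num.sqrt 2)^-1.

Let h0 : 0 < h. Proof. by rewrite invr_gt0 sqrtr_gt0. Qed.
Let h2 : h ^+ 2 = 2^-1. Proof. by rewrite exprVn sqr_sqrtr. Qed.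

Let scale_map (c d : R) (s : seq V) :
  [seq c *: a | a <- [seq d *: a | a <- s]] = [seq (c * d) *: a | a <- s].
Proof. by rewrite -map_comp; apply: eq_map => a /=; rewrite scalerA. Qed.

(** From the scale 2^(-r/2) d back to the scale d, losing the power 2^r of the
    constant: by commutation, A A F <= k A B F = k B A F <= k^2 B B F. *)
Lemma softmax_doubling (k : R) r d : 0 <= k ->
  (forall u, (gconv [seq (h ^+ r * d) *: a | a <- sA] softmax u <=
             k%:E * gconv [seq (h ^+ r * d) *: a | a <- sB] softmax u)%E) ->
  forall u, (gconv [seq d *: a | a <- sA] softmax u <=
             (k ^+ (2 ^ r))%:E * gconv [seq d *: a | a <- sB] softmax u)%E.
Proof.
move=> k0; elim: r d => [|r IH] d H u.
  by have := H u; rewrite expn0 expr1 expr0 mul1r.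
have nF := ge0_mfun_softmax.
have {}H := IH (h * d) (fun u => eq_ind _ (fun x => (gconv [seq x *: a | a <- sA] softmax u <=
   k%:E * gconv [seq x *: a | a <- sB] softmax u)%E) (H u) _ (etrans (congr1 (fun y => y * d) (exprSr h r)) (esym (mulrA _ _ _)))).
have {}H u' := H u'.
set L := k ^+ (2 ^ r) in H.
have L0 : 0 <= L by rewrite exprn_ge0.
rewrite -(gconv_half [seq d *: a | a <- sA])// -(gconv_half [seq d *: a | a <- sB])//.
rewrite !scale_map -/h.
set A := gconv _; set B := gconv [seq _ | a <- sB].
have nA G : ge0_mfun G -> ge0_mfun (A G) by exact: ge0_mfun_gconv.
have nB G : ge0_mfun G -> ge0_mfun (B G) by exact: ge0_mfun_gconv.
have step (G : V -> \bar R) : ge0_mfun G -> A (B G) = B (A G) by move=> nG; exact: gconvC.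
have scale (t : seq V) (G : V -> \bar R) v : ge0_mfun G ->
    (L%:E * gconv t G v)%E = gconv t (fun w => L%:E * G w)%E v.
  by move=> nG; rewrite gconvZ.
apply: (@le_trans _ _ (L%:E * A (B softmax) u)%E).
  rewrite (scale _ (B softmax)); last exact: nB.
  apply: gconv_le; first exact: nA.
    by apply: ge0_mfunZ => //; exact: nB.
  by move=> v; exact: H.
rewrite step// expnS mul2n -addnn exprD -/L EFinM -muleA lee_wpmul2l ?lee_fin//.
rewrite (scale _ (B softmax)); last exact: nB.
apply: gconv_le; first exact: nA.
  by apply: ge0_mfunZ => //; exact: nB.
by move=> v; exact: H.
Qed.

(** The factor lost is (1 + 4 K d^3)^(2^r) with d = 2^(-r/2), hence at most
    exp (4 K d), which tends to 1. *)
Lemma slepian_softmax u : (gconv sA softmax u <= gconv sB softmax u)%E.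
Proof.
have one (s : seq V) : [seq 1 *: a | a <- s] = s.
  by rewrite -[RHS]map_id; apply: eq_map => a /=; exact: scale1r.
have h1 : `|h| < 1.
  rewrite gtr0_norm//; have : h ^+ 2 < 1 by rewrite h2 invf_lt1// ltr1n.
  by rewrite expr_lt1 ?(ltW h0).
have hr : (fun r => h ^+ r) @ \oo --> (0 : R) by exact: cvg_expr.
have Mr : (fun r => (h ^+ r) ^+ 2 * M) @ \oo --> (0 : R).
  have -> : (fun r => (h ^+ r) ^+ 2 * M) = (fun r => h ^+ r * h ^+ r * M).
    by apply/funext => r; rewrite expr2.
  rewrite (_ : 0 = 0 * 0 * M :> R); last by rewrite !mul0r.
  by apply: cvgM; [exact: cvgM|exact: cvg_cst].
have key : \forall r \near \oo, (gconv sA softmax u <=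
    (expR (4 * K * h ^+ r))%:E * gconv sB softmax u)%E.
  near=> r.
  have hr0 : 0 < h ^+ r by exact: exprn_gt0.
  have rM : (h ^+ r) ^+ 2 * M <= 16^-1.
    near: r; move/cvgr_le : Mr; apply; by rewrite invr_gt0.
  have k0 : 0 <= 1 + 4 * K * (h ^+ r) ^+ 3.
    apply: addr_ge0; first exact: ler01.
    apply: mulr_ge0; last by apply: exprn_ge0; exact: ltW.
    by apply: mulr_ge0; [exact: ler0n|exact: K0].
  have := @softmax_doubling (1 + 4 * K * (h ^+ r) ^+ 3) r 1 k0.
  rewrite mulr1 !one => /(_ (softmax_step hr0 rM) u) /le_trans; apply.
  apply: lee_wpmul2r; first by case: (ge0_mfun_gconv sB ge0_mfun_softmax).
  rewrite lee_fin; apply: (@le_trans _ _ (expR (4 * K * (h ^+ r) ^+ 3) ^+ (2 ^ r))).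
    apply: lerXn2r; rewrite ?nnegrE ?expR_ge0//; exact: expR_ge1Dx.
  rewrite -expRM_natl ler_expR le_eqVlt; apply/orP; left; apply/eqP.
  have e : (2 ^ r)%:R * (h ^+ r) ^+ 2 = 1.
    by rewrite natrX exprAC h2 -exprMn divff// expr1n.
  rewrite exprS; transitivity (4 * K * h ^+ r * ((2 ^ r)%:R * (h ^+ r) ^+ 2)).
    by ring.
  by rewrite e mulr1.
have g0 : (0 <= gconv sB softmax u)%E by have [_] := ge0_mfun_gconv sB ge0_mfun_softmax; exact.
move: key g0; case: (gconv sB softmax u) => [y| |] key y0.
(* If the right-hand side is finite, let r tend to infinity in key. *)
- apply: (cvge_to_ge (f := fun r => (expR (4 * K * h ^+ r))%:E * y%:E)%E) key.
  apply: cvg_EFin; first by apply: nearW => r.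
  rewrite -[X in _ --> X]mul1r; apply: cvgM; last exact: cvg_cst.
  rewrite -[X in _ --> X](@expR0 R); apply: continuous_cvg; first exact: continuous_expR.
  rewrite -[X in _ --> X](mulr0 (4 * K)).
  by apply: cvgM; [exact: cvg_cst|exact: hr].
- by rewrite leey.
- by move: y0.
Unshelve. all: by end_near.
Qed.

End slepian.

(** * Averaging operators as expectations over independent normal variables *)

Section indep.
Context {R : realType} d (T : measurableType d) (P : probability T R).
Context (I : finType) (X : I -> {RV P >-> R}).
Hypothesis iid : iid_std_normal X.
Local Notation gam := (@normal_prob R 0 1).

(** Events given by the variables other than [X l]; they are stable under
    intersection, so an independence statement extends to what they
    generate. *)
Definition others (l : I) : set (set T) :=
  [set E | exists2 B : I -> set R, (forall i, measurable (B i)) &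
     E = \bigcap_(i in [set i | i != l]) (X i @^-1` B i)].

Lemma measurable_pre i (B : set R) : measurable B -> measurable (X i @^-1` B).
Proof.
by move=> mB; rewrite -[X in measurable X]setTI; exact: (measurable_funP (X i)).
Qed.

Lemma pre_gam i (B : set R) : measurable B -> P (X i @^-1` B) = gam B.
Proof. by move=> mB; have [_ H] := iid; exact: H. Qed.

(** Both sides are finite measures in E that agree on the generating
    events by the product rule. *)
Lemma others_indep l (B : set R) E : measurable B -> <<s others l >> E ->
  P (X l @^-1` B `&` E) = (gam B * P E)%E.
Proof.
move=> mB sE.
have [ind _] := iid.
have fB : gam B \is a fin_num by rewrite fin_num_measure.
have fB0 : 0 <= fine (gam B) by rewrite fine_ge0.
pose m1 := mrestr P (measurable_pre l mB).
pose m2 := mscale (NngNum fB0) P.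
have mO : others l `<=` measurable.
  move=> F [C mC ->]; apply: fin_bigcap_measurable; first exact: finite_finset.
  by move=> i _; exact: measurable_pre.
suff : m1 E = m2 E by rewrite /m1 /m2 /mrestr /mscale/= fineK// setIC.
apply: (@g_sigma_algebra_measure_unique _ _ _ (others l) mO (fun=> setT)) => //.
- by move=> _; exists (fun=> setT) => //; rewrite bigcapT.
- by rewrite bigcup_const//; exists 0%N.
- move=> F G [C mC ->] [D mD ->]; exists (fun i => C i `&` D i).
    by move=> i; exact: measurableI.
  apply/seteqP; split => [w [h1 h2] i il|w h]; first by split; [exact: h1|exact: h2].
  by split => i il; have [] := h i il.
- move=> F [C mC ->].
  suff : (P (\bigcap_(i in [set i | i != l]) X i @^-1` C i `&` X l @^-1` B) =
     (fine (gam B))%:E * P (\bigcap_(i in [set i | i != l]) X i @^-1` C i))%E by [].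
  rewrite fineK//.
  have := ind (~: [set l])%SET C mC.
  have -> : [set` (~: [set l])%SET] = [set i | i != l].
    by apply/seteqP; split => i /=; rewrite !inE.
  move=> ->.
  pose D i := if i == l then B else C i.
  have mD i : measurable (D i) by rewrite /D; case: ifP.
  have := ind [set: I]%SET D mD.
  have -> : \bigcap_(i in [set` [set: I]%SET]) (X i @^-1` D i) =
      \bigcap_(i in [set i | i != l]) (X i @^-1` C i) `&` X l @^-1` B.
    apply/seteqP; split => [w h|w [h1 h2] i _ /=].
      split; last by have := h l; rewrite /D eqxx /=; apply; rewrite inE.
      by move=> i /= il; have := h i; rewrite /D (negbTE il)/=; apply; rewrite inE.
    by rewrite /D; case: eqP => [->//|/eqP il]; exact: h1.
  move=> ->; rewrite (bigD1 l) ?inE//=; congr (_ * _)%E.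
    by rewrite /D eqxx pre_gam.
  apply: eq_big => [i|i]; first by rewrite !inE.
  by rewrite inE /= => il; rewrite /D (negbTE il).
- by move=> k; rewrite /m1 /mrestr/= (le_lt_trans (probability_le1 _ _)) ?ltry//; exact: measurableI (measurable_pre _ _).
Qed.

Context {N : nat}.
Local Notation V := 'rV[R]_N.
Variable a : I -> V.

Definition lincomb (s : seq I) (w : T) : V := \sum_(i <- s) X i w *: a i.

Lemma measurable_sum_rV d' (T' : measurableType d') (s : seq I) (Y : I -> T' -> R) :
  (forall i, i \in s -> measurable_fun [set: T'] (Y i)) ->
  measurable_fun [set: T'] (fun w => \sum_(i <- s) Y i w *: a i).
Proof.
elim: s => [|i s IH] mY.
  rewrite (_ : (fun _ => _) = cst 0); first exact: measurable_cst.
  by apply/funext => w; rewrite big_nil.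
rewrite (_ : (fun _ => _) = fun w => Y i w *: a i + \sum_(i <- s) Y i w *: a i).
  apply: measurable_rVD; first by apply: measurable_rVZ; apply: mY; rewrite mem_head.
  by apply: IH => j js; apply: mY; rewrite in_cons js orbT.
by apply/funext => w; rewrite big_cons.
Qed.

Lemma measurable_lincomb s : measurable_fun [set: T] (lincomb s).
Proof. by apply: measurable_sum_rV => i _; exact: measurable_funP. Qed.

Lemma lincomb_others l s (C : set V) : l \notin s -> measurable C ->
  <<s others l >> (lincomb s @^-1` C).
Proof.
move=> ls mC.
have : measurable_fun [set: g_sigma_algebraType (others l)] (lincomb s : g_sigma_algebraType (others l) -> V).
  apply: (measurable_sum_rV (T' := g_sigma_algebraType (others l)) (Y := fun i => X i)).
  move=> i is_ _ B mB; rewrite setTI; apply: sub_sigma_algebra.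
  exists (fun j => if j == i then B else setT); first by move=> j; case: ifP.
  apply/seteqP; split => [w Bw j jl /=|w h]; first by case: eqP => [->|].
  have := h i; rewrite eqxx; apply => /=.
  by apply: contraNneq ls => <-.
by move=> /(_ measurableT C mC); rewrite setTI.
Qed.

(** The variables are integrated out one by one: the joint law of [X l] and of
    the combination of the remaining variables is a product measure. *)
Lemma expectation_gconv s (F : V -> \bar R) (u : V) : uniq s -> ge0_mfun F ->
  (\int[P]_w F (u + lincomb s w)%R = gconv [seq a i | i <- s] F u)%E.
Proof.
elim: s F u => [|l s IH] F u.
  move=> _ nF; rewrite /lincomb /=.
  under eq_integral do rewrite big_nil addr0.
  transitivity (F u * P [set: T])%E; first exact: integral_cst.
  by rewrite probability_setT mule1.
move=> /= /andP[ls us] nF.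
rewrite gstep_gconvC//.
rewrite -IH//; last exact: ge0_mfun_gstep.
pose Y w : measurableTypeR R * V := (X l w, lincomb s w).
have mY : measurable_fun [set: T] Y.
  by apply: measurable_fun_pair; [exact: (measurable_funP (X l))|exact: measurable_lincomb].
pose W : {mfun T >-> V} := HB.pack (lincomb s)
  (isMeasurableFun.Build _ _ _ _ _ (measurable_lincomb s)).
pose G (zv : measurableTypeR R * V) := F (u + (zv.1 *: a l + zv.2)).
have mG : measurable_fun [set: measurableTypeR R * V] G.
  apply: (ge0_mfun_comp (f := fun zv : measurableTypeR R * V => u + (zv.1 *: a l + zv.2))) => //.
  apply: measurable_rVD; first exact: measurable_cst.
  by apply: measurable_rVD => //; exact: measurable_rVZ.
have G0 zv : (0 <= G zv)%E by have [_] := nF; exact.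
transitivity (\int[P]_w (G \o Y) w)%E.
  by apply: eq_integral => w _; rewrite /G /Y /= /lincomb big_cons.
pose Ym : {mfun T >-> (measurableTypeR R * V)%type} := HB.pack Y (isMeasurableFun.Build _ _ _ _ _ mY).
transitivity (\int[distribution P Ym]_zv G zv)%E.
  by rewrite ge0_integral_distribution.
transitivity (\int[(gam \x distribution P W)%E]_zv G zv)%E.
  apply: eq_measure_integral => A mA _; apply/esym.
  refine (@product_measure_unique _ _ _ _ _ gam (distribution P W) (distribution P Ym) _ A mA).
  move=> B C mB mC.
  have H : P (X l @^-1` B `&` lincomb s @^-1` C) = (gam B * P (lincomb s @^-1` C))%E.
    by apply: others_indep => //; exact: lincomb_others.
  exact: H.
rewrite (fubini_tonelli2 (m1 := gam) (m2 := distribution P W) G mG G0).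
transitivity (\int[distribution P W]_y gstep (a l) F (u + y)%R)%E.
  apply: eq_integral => v _; rewrite /gstep; apply: eq_integral => z _.
  by rewrite /G/= [z *: _ + v]addrC addrA.
rewrite ge0_integral_distribution//.
- apply: (ge0_mfun_comp (f := fun v : V => u + v)); first exact: ge0_mfun_gstep.
  by apply: measurable_rVD => //; exact: measurable_cst.
- by move=> v; have [_] := ge0_mfun_gstep (a l) nF; exact.
Qed.

End indep.

(** * The supremum over sparse unit vectors as a limit of finite maxima *)

Section dense.
Context {R : realType}.

(** Separability of any set of points seen through finitely many real
    functions: for every rational vector and precision, choose a point of the
    set within that precision of the vector whenever there is one. *)
Lemma dense_seq (T : Type) (D : finType) (S : set T) (t0 : T) (phi : D -> T -> R) :
  S t0 -> exists z : nat -> T, (forall i, S (z i)) /\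
    forall p e, S p -> 0 < e -> exists i, forall d, `|phi d p - phi d (z i)| < e.
Proof.
move=> St0.
pose Q (rk : {ffun D -> rat} * nat) t :=
  S t /\ forall d, `|phi d t - ratr (rk.1 d)| < rk.2.+1%:R^-1.
have H rk : exists t, S t /\ ((exists t', Q rk t') -> Q rk t).
  have [[t Qt]|nQ] := pselect (exists t, Q rk t).
    by exists t; split => //; case: Qt.
  by exists t0; split.
have [g gP] := choice H.
(* The pairs of a rational vector and a precision are countably many. *)
exists (fun i => if unpickle i is Some rk then g rk else t0); split.
  by move=> i; case: unpickle => // rk; case: (gP rk).
move=> p e Sp e0.
have [k ke] : exists k, k.+1%:R^-1 < e / 2 :> R.
  have e2 : 0 < e / 2 by rewrite divr_gt0.
  exists (Num.truncn (e / 2)^-1).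
  by rewrite -[ltRHS]invrK ltf_pV2 ?posrE ?invr_gt0// truncnS_gt.
have k0 : 0 < k.+1%:R^-1 :> R by rewrite invr_gt0.
have approx (c x : R) : 0 < c -> exists r : rat, `|x - ratr r| < c.
  move=> c0; have [|r] := @rat_in_itvoo R (x - c) (x + c); first by lra.
  by rewrite in_itv/= => /andP[h1 h2]; exists r; rewrite ltr_norml; apply/andP; split; lra.
have tri (c x y z : R) : c < e / 2 -> `|x - z| < c -> `|y - z| < c -> `|x - y| < e.
  rewrite !ltr_norml => ce /andP[h1 h2] /andP[h3 h4].
  by apply/andP; split; lra.
have /choice[r rP] : forall d, exists r : rat, `|phi d p - ratr r| < k.+1%:R^-1.
  by move=> d; exact: approx.
have Qp : Q ([ffun d => r d], k) p by split => // d; rewrite ffunE.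
exists (pickle ([ffun d => r d], k)); rewrite pickleK => d.
have [_ /(_ (ex_intro _ p Qp)) [_ /(_ d)]] := gP ([ffun d => r d], k).
rewrite /= ffunE; exact: tri ke (rP d).
Qed.

Fixpoint prefix_max (f : nat -> R) N := if N is N'.+1 then Num.max (prefix_max f N') (f N) else f 0%N.

Lemma prefix_max_ge f N t : (t <= N)%N -> f t <= prefix_max f N.
Proof.
elim: N => [|N IH]; first by rewrite leqn0 => /eqP ->.
rewrite leq_eqVlt => /predU1P[->|]; first by rewrite /= le_max lexx orbT.
by rewrite ltnS => /IH h; rewrite /= le_max h.
Qed.

Lemma prefix_max_ex f N : exists2 t, (t <= N)%N & prefix_max f N = f t.
Proof.
elim: N => [|N [t tN e]]; first by exists 0%N.
rewrite /= maxEle; case: ifP => _; first by exists N.+1.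
by exists t => //; exact: leqW.
Qed.

Lemma prefix_max_nd f : nondecreasing_seq (prefix_max f).
Proof. by apply/nondecreasing_seqP => N /=; rewrite le_max lexx. Qed.

Lemma cvg_prefix_max f s : (forall t, f t <= s) -> (forall e, 0 < e -> exists t, s - e < f t) ->
  prefix_max f @ \oo --> s.
Proof.
move=> fs sf; apply/cvgrPdist_lt => e e0.
have [t ft] := sf e e0; near=> N.
have [t' _ E] := prefix_max_ex f N.
have h1 : prefix_max f N <= s by rewrite E.
have h2 : f t <= prefix_max f N by apply: prefix_max_ge; near: N; exists t.
by rewrite ger0_norm ?subr_ge0//; lra.
Unshelve. all: by end_near. Qed.

Lemma measurable_prefix_max d (T : measurableType d) (F : nat -> T -> R) N :
  (forall t, measurable_fun [set: T] (F t)) ->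
  measurable_fun [set: T] (fun w => prefix_max (F ^~ w) N).
Proof. by move=> mF; elim: N => [|N IH] //=; exact: measurable_maxr. Qed.

Section sup.
Variables (m n k : nat).
Hypotheses (m0 : (0 < m)%N) (k0 : (0 < k)%N) (kn : (k <= n)%N).

Definition bilform (A : 'M[R]_(m, n)) (x : 'cV[R]_n) (y : 'cV[R]_m) : R :=
  \sum_i \sum_j A i j * (y i 0 * x j 0).

Definition pairs : set ('cV[R]_n * 'cV[R]_m) :=
  [set p | S_ric k p.1 /\ l2norm p.2 = 1].

Lemma l2norm1 l (x : 'cV[R]_l) : l2norm x = 1 -> \sum_i x i 0 ^+ 2 = 1.
Proof.
move=> h; rewrite -[LHS]sqr_sqrtr; first by rewrite -/(l2norm x) h expr1n.
by apply: sumr_ge0 => i _; exact: sqr_ge0.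
Qed.

Lemma l2norm1_le1 l (x : 'cV[R]_l) i : l2norm x = 1 -> `|x i 0| <= 1.
Proof.
move=> /l2norm1 h; rewrite -(@ler_pXn2r _ 2)// ?nnegrE// real_normK ?num_real//.
rewrite expr1n -h (bigD1 i)//= lerDl.
by apply: sumr_ge0 => j _; exact: sqr_ge0.
Qed.

Lemma pairs_nonempty : exists p, pairs p.
Proof.
have kR : 0 < k%:R :> R by rewrite ltr0n.
pose x : 'cV[R]_n := \col_j (if (j < k)%N then (Num.sqrt k%:R)^-1 else 0).
pose y : 'cV[R]_m := \col_i (if i == Ordinal m0 then 1 else 0).
have sx (c : R) : \sum_(j < n) (if (j < k)%N then c else 0) = c *+ k.
  by rewrite -big_mkcond /= (big_ord_narrow kn) sumr_const card_ord.
exists (x, y); split; last first.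
  rewrite /l2norm (bigD1 (Ordinal m0))//= mxE eqxx big1 ?expr1n ?addr0 ?sqrtr1//.
  by move=> i /negbTE h; rewrite mxE h expr0n.
split=> /=.
  rewrite /l2norm (eq_bigr (fun j : 'I_n => if (j < k)%N then k%:R^-1 else 0)).
    by rewrite sx -[k%:R^-1 *+ k]mulr_natr mulVf ?gt_eqF// sqrtr1.
  move=> j _; rewrite mxE; case: ifP => _; last by rewrite expr0n.
  by rewrite exprVn sqr_sqrtr// ltW.
rewrite /l0norm -sum1_card.
rewrite (eq_bigl (fun j : 'I_n => (j < k)%N)).
  by rewrite (big_ord_narrow kn) sum1_card card_ord.
move=> j; rewrite inE mxE; case: ifP => _; last by rewrite eqxx.
by rewrite invr_eq0 gt_eqF// sqrtr_gt0.
Qed.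

Lemma l2norm_ge0 l (v : 'cV[R]_l) : 0 <= l2norm v.
Proof. exact: sqrtr_ge0. Qed.

Lemma l2norm_sq l (v : 'cV[R]_l) : l2norm v ^+ 2 = \sum_i v i 0 ^+ 2.
Proof. by rewrite sqr_sqrtr//; apply: sumr_ge0 => i _; exact: sqr_ge0. Qed.

Lemma bilformE A x y : bilform A x y = \sum_i y i 0 * (A *m x) i 0.
Proof.
apply: eq_bigr => i _; rewrite mxE mulr_sumr; apply: eq_bigr => j _.
by rewrite mulrCA.
Qed.

(** Cauchy-Schwarz. *)
Lemma dot_le_l2norm l (y v : 'cV[R]_l) : l2norm y = 1 -> \sum_i y i 0 * v i 0 <= l2norm v.
Proof.
move=> y1; have := l2norm_ge0 v; rewrite le_eqVlt => /predU1P[v0|v0].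
  rewrite -v0 big1// => i _.
  have : \sum_i v i 0 ^+ 2 = 0 by rewrite -l2norm_sq -v0 expr0n.
  move/eqP; rewrite psumr_eq0 => [|j _]; last exact: sqr_ge0.
  by move=> /allP /(_ i (mem_index_enum _)); rewrite sqrf_eq0 => /eqP ->; rewrite mulr0.
have le i : y i 0 * v i 0 <= (l2norm v * y i 0 ^+ 2 + (l2norm v)^-1 * v i 0 ^+ 2) / 2.
  rewrite -subr_ge0.
  have -> : (l2norm v * y i 0 ^+ 2 + (l2norm v)^-1 * v i 0 ^+ 2) / 2 - y i 0 * v i 0 =
    (l2norm v)^-1 * (l2norm v * y i 0 - v i 0) ^+ 2 / 2 by field; rewrite gt_eqF.
  by rewrite divr_ge0// mulr_ge0 ?invr_ge0 ?(ltW v0)// sqr_ge0.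
apply: (le_trans (ler_sum _ (fun i _ => le i))).
rewrite -mulr_suml big_split /= -!mulr_sumr l2norm1// -l2norm_sq.
have -> : (l2norm v)^-1 * l2norm v ^+ 2 = l2norm v by field; rewrite gt_eqF.
by lra.
Qed.

Lemma has_sup_xi (A : 'M[R]_(m, n)) : has_sup [set l2norm (A *m x) | x in @S_ric R n k].
Proof.
have [p0 [px0 _]] := pairs_nonempty.
split; first by exists (l2norm (A *m p0.1)); exists p0.1.
exists (Num.sqrt (\sum_i (\sum_j `|A i j|) ^+ 2)) => _ [x [x1 _] <-].
rewrite ler_wsqrtr//; apply: ler_sum => i _.
rewrite -real_normK ?num_real//; apply: lerXn2r; rewrite ?nnegrE//.
  by apply: sumr_ge0.
rewrite mxE; apply: (le_trans (ler_norm_sum _ _ _)); apply: ler_sum => j _.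
by rewrite normrM ler_piMr// l2norm1_le1.
Qed.

Lemma bilform_le_xi A p : pairs p -> bilform A p.1 p.2 <= xi_uric k A.
Proof.
case=> px py; rewrite bilformE; apply: (le_trans (dot_le_l2norm _ py)).
by apply: sup_upper_bound; [exact: has_sup_xi|exists p.1].
Qed.

(** The supremum is taken over x only; the optimal y is the normalized A x. *)
Lemma xi_approx A e : 0 < e -> exists2 p, pairs p & xi_uric k A - e < bilform A p.1 p.2.
Proof.
move=> e0.
have [[x0 y0] [/= px0 py0]] := pairs_nonempty.
have [_ [x xS <-] lt] := sup_adherent e0 (has_sup_xi A).
set v := A *m x in lt.
have [v0|v0] := eqVneq (l2norm v) 0.
  exists (x, y0); first by split.
  rewrite bilformE /= -/v big1 -?v0// => i _.
  have : \sum_i v i 0 ^+ 2 = 0 by rewrite -l2norm_sq v0 expr0n.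
  move/eqP; rewrite psumr_eq0 => [|j _]; last exact: sqr_ge0.
  by move=> /allP /(_ i (mem_index_enum _)); rewrite sqrf_eq0 => /eqP ->; rewrite mulr0.
have vp : 0 < l2norm v by rewrite lt_neqAle eq_sym v0 l2norm_ge0.
have yE i : ((l2norm v)^-1 *: v) i 0 = (l2norm v)^-1 * v i 0 by rewrite mxE.
exists (x, (l2norm v)^-1 *: v).
  split => //=; rewrite /l2norm; under eq_bigr do rewrite yE exprMn.
  by rewrite -mulr_sumr -l2norm_sq -exprMn mulVf// expr1n sqrtr1.
rewrite bilformE /= -/v; under eq_bigr do rewrite yE -mulrA -expr2.
rewrite -mulr_sumr -l2norm_sq expr2 mulrA mulVf// mul1r; exact: lt.
Qed.

Lemma bilform_dist A p p' e : pairs p -> pairs p' -> 0 <= e ->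
  (forall j, `|p.1 j 0 - p'.1 j 0| <= e) -> (forall i, `|p.2 i 0 - p'.2 i 0| <= e) ->
  bilform A p.1 p.2 - bilform A p'.1 p'.2 <= (\sum_i \sum_j `|A i j|) * (2 * e).
Proof.
move=> [[px _] py] [[px' _] py'] e0 h1 h2.
rewrite /bilform -sumrB mulr_suml; apply: ler_sum => i _.
rewrite -sumrB mulr_suml; apply: ler_sum => j _.
rewrite -mulrBr; apply: (le_trans (ler_norm _)); rewrite normrM ler_wpM2l//.
have -> : p.2 i 0 * p.1 j 0 - p'.2 i 0 * p'.1 j 0 =
  p.2 i 0 * (p.1 j 0 - p'.1 j 0) + (p.2 i 0 - p'.2 i 0) * p'.1 j 0 by ring.
apply: (le_trans (ler_normD _ _)); rewrite !normrM mulr_natl mulr2n.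
apply: lerD.
  rewrite -[leRHS]mul1r; apply: ler_pM => //; exact: l2norm1_le1.
rewrite -[leRHS]mulr1; apply: ler_pM => //; exact: l2norm1_le1.
Qed.

(** A single sequence of pairs serves all matrices, because the bilinear forms
    are uniformly continuous on pairs of unit vectors (bilform_dist).  Hence
    xi_uric is a pointwise limit of maxima of finitely many Gaussian
    variables. *)
Lemma exists_dense_pairs : exists z : nat -> 'cV[R]_n * 'cV[R]_m, (forall t, pairs (z t)) /\
  forall A : 'M[R]_(m, n),
    prefix_max (fun t => bilform A (z t).1 (z t).2) @ \oo --> xi_uric k A.
Proof.
have [p0 pp0] := pairs_nonempty.
pose phi (d : 'I_n + 'I_m) (p : 'cV[R]_n * 'cV[R]_m) : R :=
  match d with inl j => p.1 j 0 | inr i => p.2 i 0 end.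
have [z [pz dz]] := dense_seq phi pp0.
exists z; split => // A; apply: cvg_prefix_max => [t|e e0]; first exact: bilform_le_xi.
have e2 : 0 < e / 2 by rewrite divr_gt0.
have [p pp lt] := xi_approx A e2.
set B := \sum_i \sum_j `|A i j|.
have B0 : 0 <= B by apply: sumr_ge0 => i _; apply: sumr_ge0.
pose e' := e / 4 / (B + 1).
have B1 : 0 < B + 1 by lra.
have e'0 : 0 < e' by rewrite divr_gt0// divr_gt0.
have [t tP] := dz p e' pp e'0; exists t.
have := @bilform_dist A p (z t) e' pp (pz t) (ltW e'0) (fun j => ltW (tP (inl j))) (fun i => ltW (tP (inr i))).
rewrite -/B; have : B * (2 * e') <= e / 2.
  have -> : e / 2 = (B + 1) * (2 * e') by rewrite /e'; field; rewrite gt_eqF.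
  by rewrite ler_wpM2r// ?lerDl// mulr_ge0// ltW.
by lra.
Qed.

End sup.
End dense.

(** * Exponential moments of the maximal stretch *)

Lemma quarter_lt (R : realType) (c g : R) : 0 < g -> c / 2 < g -> c / (4 * g) < 2^-1.
Proof. by move=> g0 cg; rewrite ltr_pdivrMr ?mulr_gt0//; lra. Qed.

Section compare.
Context {R : realType}.
Variables (m n k : nat) (N : nat).
Variables (x : nat -> 'cV[R]_n) (y : nat -> 'cV[R]_m).
Hypotheses (xS : forall t, S_ric k (x t)) (yS : forall t, l2norm (y t) = 1).
Local Notation V := 'rV[R]_N.+1.
Local Notation gam := (@normal_prob R 0 1).

(** The directions of the two Gaussian vectors indexed by the pairs
    (x_t, y_t): [sA] for y_t^T A x_t + z, where [one_rV] is the
    direction of the shared variable z, and [sB] for y_t.g + x_t.h. *)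
Definition prod_dir (l : 'I_m * 'I_n) : V := \row_t (y t l.1 0 * x t l.2 0).
Definition one_rV : V := \row_t 1.
Definition sum_dir (l : 'I_m + 'I_n) : V :=
  \row_t match l with inl i => y t i 0 | inr j => x t j 0 end.

Definition sA := one_rV :: [seq prod_dir l | l <- index_enum _].
Definition sB := [seq sum_dir l | l <- index_enum _].

Let ip l (u v : 'cV[R]_l) := \sum_i u i 0 * v i 0.

Let ip11 l (u : 'cV[R]_l) : l2norm u = 1 -> ip u u = 1.
Proof. by move=> /l2norm1 <-; apply: eq_bigr => i _; rewrite expr2. Qed.

Let ip_le1 l (u v : 'cV[R]_l) : l2norm u = 1 -> l2norm v = 1 -> ip u v <= 1.
Proof. by move=> u1 v1; rewrite -v1; exact: dot_le_l2norm. Qed.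

Lemma covA t t' : cov sA t t' = 1 + ip (y t) (y t') * ip (x t) (x t').
Proof.
rewrite /cov /sA big_cons !mxE mulr1 big_map; congr (_ + _).
rewrite /ip big_distrl /= (eq_bigr (fun i => \sum_j (y t i 0 * y t' i 0) * (x t j 0 * x t' j 0))).
  rewrite pair_bigA /=; apply: eq_bigr => l _.
  by rewrite !mxE mulrACA.
by move=> i _; rewrite mulr_sumr.
Qed.

Lemma covB t t' : cov sB t t' = ip (y t) (y t') + ip (x t) (x t').
Proof.
rewrite /cov /sB big_map big_sumType /=.
by congr (_ + _); apply: eq_bigr => i _; rewrite !mxE.
Qed.

Lemma cov_diag t : cov sA t t = cov sB t t.
Proof. by rewrite covA covB !ip11// ?mulr1//; case: (xS t). Qed.

(** The difference of the covariances is (1 - <y, y'>) (1 - <x, x'>). *)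
Lemma cov_le t t' : cov sB t t' <= cov sA t t'.
Proof.
rewrite covA covB.
have h1 := ip_le1 (yS t) (yS t').
have h2 : ip (x t) (x t') <= 1 by apply: ip_le1; [case: (xS t)|case: (xS t')].
have : 0 <= (1 - ip (y t) (y t')) * (1 - ip (x t) (x t')) by rewrite mulr_ge0// subr_ge0.
lra.
Qed.

Variables (theta q : R).
Hypothesis (q01 : 0 < q < 1) (th0 : 0 < theta).
Let c := theta * q.

Let c0 : 0 < c. Proof. by rewrite mulr_gt0//; case/andP: q01. Qed.

(** A variable shared by all coordinates factors out of [softmax], since
    theta q = c. *)
Lemma gstep_one : gstep one_rV (softmax theta q : V -> \bar R) =
  (fun u => (expR (c ^+ 2 / 2))%:E * softmax theta q u)%E.
Proof.
apply/funext => u; rewrite /gstep.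
have E z : softmax theta q (u + z *: one_rV) = (softmax theta q u * (expR (c * z))%:E)%E.
  rewrite /softmax -EFinM; congr EFin.
  have -> : sumexp theta (u + z *: one_rV) = sumexp theta u * expR (theta * z).
    rewrite /sumexp mulr_suml; apply: eq_bigr => i _.
    by rewrite !mxE mulr1 mulrDr expRD.
  rewrite powRM ?expR_ge0//; last by apply: sumr_ge0 => i _; exact: expR_ge0.
  by rewrite -expRM /c mulrAC.
under eq_integral do rewrite E.
rewrite ge0_integralZ ?powR_ge0//.
  by rewrite gam_expR muleC.
by apply/measurable_EFinP; apply: measurableT_comp => //; exact: measurable_funM.
Qed.

Lemma softmax_ge (v : V) t : ((expR (c * v 0 t)%R)%:E <= softmax theta q v)%E.
Proof.
rewrite lee_fin (_ : c * v 0 t = theta * v 0 t * q); last by rewrite /c mulrAC.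
have q0 : 0 <= q by case/andP: q01 => /ltW.
have s0 := ltW (sumexp_gt0 theta (ltn0Sn N) v).
rewrite expRM; apply: ge0_ler_powR; rewrite ?nnegrE ?expR_ge0//.
rewrite /sumexp (bigD1 t)//= lerDl.
by apply: sumr_ge0 => i _; exact: expR_ge0.
Qed.

Lemma softmax_le (v : V) b : (forall t, v 0 t <= b) ->
  (softmax theta q v <= (N.+1%:R `^ q * expR (c * b))%:E)%E.
Proof.
move=> vb; rewrite lee_fin.
have -> : expR (c * b) = expR (theta * b) `^ q by rewrite -expRM /c mulrAC.
have q0 : 0 <= q by case/andP: q01 => /ltW.
have s0 := ltW (sumexp_gt0 theta (ltn0Sn N) v).
rewrite -powRM ?expR_ge0//; apply: ge0_ler_powR; rewrite ?nnegrE ?mulr_ge0 ?expR_ge0//.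
rewrite mulr_natl -[N.+1 in leRHS]card_ord -sumr_const; apply: ler_sum => t _.
by rewrite ler_expR ler_wpM2l// ltW.
Qed.

Variables (g1 g2 nu : R).
Hypotheses (g1c : c / 2 < g1) (g2c : c / 2 < g2) (nu0 : 0 <= nu).

Let g10 : 0 < g1. Proof. by apply: lt_trans g1c; rewrite divr_gt0. Qed.
Let g20 : 0 < g2. Proof. by apply: lt_trans g2c; rewrite divr_gt0. Qed.

Definition excess (h : R) := Num.max (h ^+ 2 / (4 * g2) - nu) 0.

(** (2 g b - a)^2 >= 0. *)
Lemma amgm (g a b : R) : 0 < g -> a * b <= g * b ^+ 2 + a ^+ 2 / (4 * g).
Proof.
move=> g0; rewrite -subr_ge0.
have -> : g * b ^+ 2 + a ^+ 2 / (4 * g) - a * b = (2 * g * b - a) ^+ 2 / (4 * g).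
  by field; rewrite gt_eqF.
by rewrite divr_ge0 ?sqr_ge0// mulr_ge0// ltW.
Qed.

(** The linearization with multipliers: g1 and g2 for the unit norms of y
    and x, nu for the k nonzero entries of x.  A zero entry of x contributes 0,
    and an excess is nonnegative, so it may be added for every index. *)
Lemma sum_dir_le (z : 'I_m + 'I_n -> R) t :
  (\sum_(l <- index_enum _) z l *: sum_dir l) 0 t <=
  g1 + \sum_i z (inl i) ^+ 2 / (4 * g1) + (g2 + nu * k%:R + \sum_j excess (z (inr j))).
Proof.
rewrite summxE (eq_bigr (fun l => z l * sum_dir l 0 t)); last by move=> l _; rewrite mxE.
rewrite big_sumType /=; apply: lerD.
  have := l2norm1 (yS t) => y1.
  have -> : g1 + \sum_i z (inl i) ^+ 2 / (4 * g1) =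
      \sum_i (g1 * y t i 0 ^+ 2 + z (inl i) ^+ 2 / (4 * g1)).
    by rewrite big_split -mulr_sumr y1 mulr1.
  by apply: ler_sum => i _ /=; rewrite mxE; exact: amgm.
have [/l2norm1 x1 xk] := xS t.
have -> : g2 = \sum_j g2 * x t j 0 ^+ 2 by rewrite -mulr_sumr x1 mulr1.
have -> : nu * k%:R = \sum_j (if x t j 0 != 0 then nu else 0).
  rewrite -big_mkcond sumr_const mulr_natr -xk /l0norm; congr (_ *+ _).
  by apply: eq_card => j; rewrite inE.
rewrite -!big_split; apply: ler_sum => j _ /=; rewrite mxE /excess.
case: eqP => [->|_] /=.
  by rewrite expr0n !mulr0 !add0r le_max lexx orbT.
apply: (le_trans (amgm _ _ g20)); rewrite -addrA lerD2l.
by rewrite -lerBlDl le_max lexx.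
Qed.

Lemma measurable_excess : measurable_fun [set: R] (fun h => expR (c * excess h)).
Proof.
apply: measurableT_comp => //; apply: measurable_funM => //.
apply: measurable_maxr => //; apply: measurable_funB => //.
by apply: measurable_funM => //; exact: measurable_funX.
Qed.

Definition linearized_mgf (l : 'I_m + 'I_n) (h : R) : R :=
  match l with inl _ => expR (c / (4 * g1) * h ^+ 2) | inr _ => expR (c * excess h) end.

(** The linearized bound is a sum of functions of single normal variables, so
    its exponential has a product of explicit means. *)
Lemma gconvB_le : (gconv sB (softmax theta q : V -> \bar R) 0 <=
  (N.+1%:R `^ q * (expR (c * (g1 + g2 + nu * k%:R)) *
    ((Num.sqrt (1 - c / (2 * g1)))^-1 ^+ m * I_uric_fun c g2 nu ^+ n)))%:E)%E.
Proof.
have nF : ge0_mfun (softmax theta q : V -> \bar R) by exact: ge0_mfun_softmax.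
have := @gconv_prod_le R N.+1 _ (index_enum ('I_m + 'I_n)%type) sum_dir linearized_mgf _ 0
  (N.+1%:R `^ q * expR (c * (g1 + g2 + nu * k%:R))) (index_enum_uniq _) _ nF.
move=> H; apply: (le_trans (H _ _ _ _)).
- by rewrite mulr_ge0 ?powR_ge0 ?expR_ge0.
- case=> l /=; last exact: measurable_excess.
  by apply: measurableT_comp => //; apply: measurable_funM => //; exact: measurable_funX.
- by case=> l h /=; exact: expR_ge0.
- move=> z; rewrite add0r; apply: (le_trans (softmax_le (sum_dir_le z))).
  rewrite lee_fin -mulrA ler_wpM2l ?powR_ge0// big_sumType /=.
  rewrite -!expR_sum -!expRD ler_expR le_eqVlt; apply/orP; left; apply/eqP.
  rewrite -[\sum_(i < m) c / _ * _]mulr_sumr -[\sum_(i < n) c * _]mulr_sumr.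
  rewrite -mulr_suml.
  by field; rewrite gt_eqF.
rewrite big_sumType /=.
have c1 := quarter_lt g10 g1c.
rewrite (eq_bigr (fun=> (Num.sqrt (1 - c / (2 * g1)))^-1%:E)); last first.
  move=> i _; rewrite gam_expR_sqr//; congr ((Num.sqrt (1 - _))^-1%:E).
  by field; rewrite gt_eqF.
rewrite [X in (_ * (_ * X))%E](eq_bigr (fun=> (I_uric_fun c g2 nu)%:E)); last first.
  by move=> j _; exact: gam_uric.
by rewrite !prodEFin !prodr_const !card_ord -!EFinM -mulrA.
Qed.

Context d (T : measurableType d) (P : probability T R).
Variable X : 'I_m * 'I_n -> {RV P >-> R}.
Hypothesis iid : iid_std_normal X.

Lemma softmax_bound :
  ((expR (c ^+ 2 / 2))%:E *
   \int[P]_w softmax theta q (lincomb X prod_dir (index_enum _) w) <=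
  (N.+1%:R `^ q * (expR (c * (g1 + g2 + nu * k%:R)) *
    ((Num.sqrt (1 - c / (2 * g1)))^-1 ^+ m * I_uric_fun c g2 nu ^+ n)))%:E)%E.
Proof.
have nF : ge0_mfun (softmax theta q : V -> \bar R) by exact: ge0_mfun_softmax.
have E := expectation_gconv iid prod_dir 0 (index_enum_uniq _) nF.
have -> : (\int[P]_w softmax theta q (lincomb X prod_dir (index_enum _) w) =
    gconv [seq prod_dir l | l <- index_enum _] (softmax theta q) 0)%E.
  by rewrite -E; apply: eq_integral => w _; rewrite add0r.
apply: le_trans gconvB_le.
apply: le_trans (slepian_softmax theta q01 (ltn0Sn N) cov_diag cov_le 0).
rewrite /sA [gconv (_ :: _) _]/= gstep_gconvC// gstep_one.
by rewrite gconvZ ?expR_ge0.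
Qed.

End compare.

Section xi_mgf.
Context {R : realType} d (T : measurableType d) (P : probability T R).
Variables (m n k : nat).
Hypotheses (m0 : (0 < m)%N) (k0 : (0 < k)%N) (kn : (k <= n)%N).
Variable X : 'I_m * 'I_n -> {RV P >-> R}.
Hypothesis iid : iid_std_normal X.

Let A (w : T) : 'M[R]_(m, n) := \matrix_(i < m, j < n) X (i, j) w.
Let xi (w : T) : R := xi_uric k (A w).

Lemma measurable_bilform x y : measurable_fun [set: T] (fun w => bilform (A w) x y).
Proof.
apply: measurable_sum => i; apply: measurable_sum => j.
apply: measurable_funM => //.
rewrite (_ : (fun w => _) = (X (i, j) : T -> R)); first exact: measurable_funP.
by apply/funext => w; rewrite mxE.
Qed.

Lemma measurable_xi : measurable_fun [set: T] xi.
Proof.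
have [z [_ cz]] := @exists_dense_pairs R m n k m0 k0 kn.
apply: (measurable_fun_cvg (h := fun N w => prefix_max (fun t => bilform (A w) (z t).1 (z t).2) N)).
  move=> N; apply: (measurable_prefix_max (F := fun t w => bilform (A w) (z t).1 (z t).2)).
  by move=> t; exact: measurable_bilform.
by move=> w _; exact: cz.
Qed.

Variables (c g1 g2 nu : R).
Hypotheses (c0 : 0 < c) (g1c : c / 2 < g1) (g2c : c / 2 < g2) (nu0 : 0 <= nu).

Let B := expR (c * (g1 + g2 + nu * k%:R)) *
    ((Num.sqrt (1 - c / (2 * g1)))^-1 ^+ m * I_uric_fun c g2 nu ^+ n).

(** Here q = 1 / (r + 2) and theta = c (r + 2); the factor (N + 1)^q of the
    comparison disappears as r tends to infinity. *)
Lemma prefix_max_mgf (z : nat -> 'cV[R]_n * 'cV[R]_m) N : (forall t, pairs k (z t)) ->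
  ((expR (c ^+ 2 / 2))%:E *
   \int[P]_w (expR (c * prefix_max (fun t => bilform (A w) (z t).1 (z t).2) N))%:E <= B%:E)%E.
Proof.
move=> pz.
set I := (\int[P]_w _)%E.
have I0 : (0 <= I)%E by apply: integral_ge0 => w _; rewrite lee_fin expR_ge0.
have key : \forall r \near \oo, ((expR (c ^+ 2 / 2))%:E * I <= (N.+1%:R `^ r.+2%:R^-1 * B)%:E)%E.
  apply: nearW => r.
  pose q : R := r.+2%:R^-1; pose theta := c * r.+2%:R.
  have q01 : 0 < q < 1 by rewrite /q invr_gt0 ltr0n/= invf_lt1 ?ltr0n// ltr1n.
  have th0 : 0 < theta by rewrite mulr_gt0// ltr0n.
  have cE : theta * q = c by rewrite /theta /q mulfK// pnatr_eq0.
  have := @softmax_bound R m n k N (fun t => (z t).1) (fun t => (z t).2)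
    (fun t => (pz t).1) (fun t => (pz t).2) theta q q01 th0 g1 g2 nu.
  rewrite cE => /(_ g1c g2c nu0 d T P X iid); apply: le_trans.
  rewrite lee_wpmul2l ?lee_fin ?expR_ge0//.
  have mF := ge0_mfun_softmax theta q (N:=N.+1) (R:=R).
  apply: ge0_le_integral => //.
  - apply/measurable_EFinP; apply: measurableT_comp => //; apply: measurable_funM => //.
    apply: (measurable_prefix_max (F := fun t w => bilform (A w) (z t).1 (z t).2)).
    by move=> t; exact: measurable_bilform.
  - by apply: ge0_mfun_comp; [exact: mF|exact: measurable_lincomb].
  move=> w _.
  have [t tN ->] := prefix_max_ex (fun t => bilform (A w) (z t).1 (z t).2) N.
  have := @softmax_ge R N theta q q01 (lincomb X (prod_dir N (fun t => (z t).1) (fun t => (z t).2)) (index_enum _) w)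
     (Ordinal (tN : (t < N.+1)%N)).
  rewrite cE; congr (((expR (c * _))%:E <= _)%E).
  rewrite /lincomb summxE /bilform pair_bigA /=; apply: eq_bigr => -[i j] _ /=.
  by rewrite !mxE.
apply: (cvge_to_ge (f := fun r => (N.+1%:R `^ r.+2%:R^-1 * B)%:E)) key.
apply: cvg_EFin; first by apply: nearW.
rewrite -[X in _ --> X]mul1r; apply: cvgM; last exact: cvg_cst.
have -> : (fun r => N.+1%:R `^ r.+2%:R^-1 : R) = (fun r => expR (r.+2%:R^-1 * ln N.+1%:R)).
  by apply/funext => r; rewrite /powR pnatr_eq0.
rewrite -[X in _ --> X](@expR0 R); apply: continuous_cvg; first exact: continuous_expR.
rewrite -[X in _ --> X](mul0r (ln N.+1%:R)); apply: cvgM; last exact: cvg_cst.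
by have := @cvg_harmonic R; rewrite -cvg_shiftS; exact.
Qed.

(** Monotone convergence along the maxima of the first N pairs. *)
Lemma xi_mgf_le : (\int[P]_w (expR (c * xi w))%:E <= (expR (- (c ^+ 2 / 2)) * B)%:E)%E.
Proof.
have [z [pz cz]] := @exists_dense_pairs R m n k m0 k0 kn.
pose f N w : \bar R := (expR (c * prefix_max (fun t => bilform (A w) (z t).1 (z t).2) N))%:E.
have mf N : measurable_fun [set: T] (f N).
  apply/measurable_EFinP; apply: measurableT_comp => //; apply: measurable_funM => //.
  apply: (measurable_prefix_max (F := fun t w => bilform (A w) (z t).1 (z t).2)).
  by move=> t; exact: measurable_bilform.
have f0 N w : [set: T] w -> (0 <= f N w)%E by move=> _; rewrite lee_fin expR_ge0.
have ndf w : [set: T] w -> nondecreasing_seq (f ^~ w).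
  move=> _ a b ab; rewrite lee_fin ler_expR ler_wpM2l ?(ltW c0)//.
  exact: prefix_max_nd.
have cvgf w : f N w @[N --> \oo] --> (expR (c * xi w))%:E.
  apply: cvg_EFin; first exact: nearW.
  apply: continuous_cvg; first exact: continuous_expR.
  by apply: cvgM; [exact: cvg_cst|exact: cz].
have := cvg_monotone_convergence (mu := P) measurableT mf f0 ndf.
have -> : (\int[P]_w limn (f ^~ w) = \int[P]_w (expR (c * xi w))%:E)%E.
  by apply: eq_integral => w _; exact: cvg_lim (cvgf w).
move=> /cvge_to_le; apply; apply: nearW => N.
have := prefix_max_mgf N pz; rewrite -/(f N) => H.
have e0 := expR_gt0 (c ^+ 2 / 2).
rewrite -(@lee_pmul2l _ (expR (c ^+ 2 / 2))%:E)//.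
by rewrite -EFinM mulrA -expRD subrr expR0 mul1r.
Qed.

End xi_mgf.

(** * Asymptotics *)

(** The closed form only depends on c / gam, c nu and nu gam. *)
Lemma I_uric_fun_scale (R : realType) (c g nu s : R) : 0 < s -> 0 < g ->
  I_uric_fun (c * s) (g * s) (nu / s) = I_uric_fun c g nu.
Proof.
move=> s0 g0; rewrite /I_uric_fun.
have s1 : s != 0 by rewrite gt_eqF.
have g1 : g != 0 by rewrite gt_eqF.
have -> : c * s / (4 * (g * s)) = c / (4 * g) by field; rewrite s1 g1.
have -> : c * s * (nu / s) = c * nu by field.
have -> : nu / s * (g * s) = nu * g by field.
by have -> : 2 * (nu / s) * (g * s) = 2 * nu * g by field.
Qed.

Lemma I_uric_fun_ge1 (R : realType) (c g nu : R) : 0 < c -> c / 2 < g -> 0 <= nu ->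
  1 <= I_uric_fun c g nu.
Proof.
move=> c0 cg nu0; rewrite -lee_fin -gam_uric//.
rewrite -[leLHS](@probability_setT _ _ _ (@normal_prob R 0 1)) -[leLHS]mul1e.
rewrite -integral_cst//; apply: ge0_le_integral => //.
  apply/measurable_EFinP; apply: measurableT_comp => //; apply: measurable_funM => //.
  apply: measurable_maxr => //; apply: measurable_funB => //.
  by apply: measurable_funM => //; exact: measurable_funX.
move=> h _; rewrite lee_fin /= -[leLHS](@expR0 R) ler_expR.
by apply: mulr_ge0; [exact: ltW|rewrite le_max lexx orbT].
Qed.

Lemma gamma_hat_gt (R : realType) (c alpha : R) : 0 < c -> 0 < alpha ->
  c / 2 < gamma_hat c alpha.
Proof.
move=> c0 a0; rewrite /gamma_hat.
suff : 2 * c < Num.sqrt (4 * c ^+ 2 + 16 * alpha) by lra.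
have <- : Num.sqrt ((2 * c) ^+ 2) = 2 * c by rewrite sqrtr_sqr ger0_norm//; lra.
by rewrite ltr_sqrt; nra.
Qed.

(** The expression whose infimum over c, g and nu is
    [uric_bound alpha beta * Num.sqrt alpha]. *)
Definition rate (R : realType) (alpha beta c g nu : R) : R :=
  - (c / 2) + (nu * beta + g + c^-1 * ln (I_uric_fun c g nu)) + I_sph c alpha.

Lemma one_minus_gamma_hat (R : realType) (c alpha : R) : 0 < c -> 0 < alpha ->
  0 < 1 - c / (2 * gamma_hat c alpha) < 1.
Proof.
move=> c0 a0; have := gamma_hat_gt c0 a0; set h := gamma_hat _ _ => ch.
have h0 : 0 < 2 * h by lra.
by rewrite subr_gt0 ltr_pdivrMr// ltrBlDl ltrDr divr_gt0//; lra.
Qed.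

(** The part of the exponent that is bounded in n; it accounts for the rounding
    of beta n and alpha n. *)
Definition offset (R : realType) (alpha c nu : R) : R :=
  c * nu - ln (1 - c / (2 * gamma_hat c alpha)) / 2.

Section mgf_rate.
Context {R : realType} d (T : measurableType d) (P : probability T R).
Variables (m n k : nat) (alpha beta : R).
Hypotheses (a0 : 0 < alpha) (m0 : (0 < m)%N) (k0 : (0 < k)%N) (kn : (k <= n)%N).
Hypotheses (ma : is_rounding (alpha * n%:R) m) (kb : is_rounding (beta * n%:R) k).
Variable X : 'I_m * 'I_n -> {RV P >-> R}.
Hypothesis iid : iid_std_normal X.
Let xi (w : T) : R := xi_uric k (\matrix_(i < m, j < n) X (i, j) w).

(** The exponential moment bound at c sqrt n, with multipliers
    gamma_hat sqrt n, g sqrt n and nu / sqrt n: all terms of the exponent become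
    linear in n. *)
Lemma xi_mgf_rate (c g nu : R) : 0 < c -> c / 2 < g -> 0 <= nu ->
  (\int[P]_w (expR (c * Num.sqrt n%:R * xi w))%:E <=
   (expR (n%:R * (c * rate alpha beta c g nu) + offset alpha c nu))%:E)%E.
Proof.
move=> c0 cg nu0; set s := Num.sqrt n%:R.
have n0 : 0 < n%:R :> R by rewrite ltr0n (leq_trans k0).
have s0 : 0 < s by rewrite sqrtr_gt0.
have ssE : s ^+ 2 = n%:R by rewrite sqr_sqrtr// ltW.
have hc := gamma_hat_gt c0 a0; set h := gamma_hat c alpha in hc *.
have h0 : 0 < h by lra.
have g0 : 0 < g by lra.
have /andP[u0 u1] := one_minus_gamma_hat c0 a0.
have cs0 : 0 < c * s by rewrite mulr_gt0.
have c1 : c * s / 2 < h * s by rewrite mulrAC ltr_pM2r.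
have c2 : c * s / 2 < g * s by rewrite mulrAC ltr_pM2r.
have nus : 0 <= nu / s by rewrite divr_ge0// ltW.
have := xi_mgf_le m0 k0 kn iid cs0 c1 c2 nus.
move=> /le_trans; apply; rewrite lee_fin I_uric_fun_scale//.
have -> : c * s / (2 * (h * s)) = c / (2 * h) by field; rewrite !gt_eqF.
set u := 1 - c / (2 * h) in u0 u1 *.
have J1 := I_uric_fun_ge1 c0 cg nu0; set J := I_uric_fun c g nu in J1 *.
have -> : (Num.sqrt u)^-1 = expR (- (ln u / 2)).
  rewrite expRN; congr (_^-1).
  have -> : u = expR (ln u / 2) ^+ 2.
    by rewrite -expRM_natl -[LHS](@lnK _ u)//; congr expR; field.
  by rewrite sqrtr_sqr ger0_norm ?expR_ge0// -expRM_natl expRK; congr expR; field.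
have -> : J = expR (ln J) by rewrite lnK// posrE; lra.
rewrite -!expRM_natl -!expRD ler_expR.
have -> : c * s * (h * s + g * s + nu / s * k%:R) = c * (h + g) * s ^+ 2 + c * nu * k%:R.
  by field; rewrite gt_eqF.
have -> : (c * s) ^+ 2 = c ^+ 2 * s ^+ 2 by rewrite exprMn.
rewrite ssE.
have kb' : k%:R <= beta * n%:R + 1 by move: kb; rewrite /is_rounding ltr_norml; lra.
have ma' : m%:R <= alpha * n%:R + 1 by move: ma; rewrite /is_rounding ltr_norml; lra.
have lu : 0 <= - ln u by rewrite oppr_ge0 ln_le0// ltW.
have e1 : c * nu * k%:R <= c * nu * (beta * n%:R + 1) by rewrite ler_wpM2l// mulr_ge0// ltW.
have e2 : m%:R * - ln u <= (alpha * n%:R + 1) * - ln u by rewrite ler_wpM2r.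
rewrite /rate /offset /I_sph -/h -/u -/J.
have -> : n%:R * (c * (- (c / 2) + (nu * beta + g + c^-1 * ln J) + (h - alpha / (2 * c) * ln u)))
  = n%:R * (- (c ^+ 2 / 2) + c * (nu * beta) + c * g + ln J + c * h - alpha / 2 * ln u).
  by field; rewrite gt_eqF.
lra.
Qed.

End mgf_rate.

Section markov_jensen.
Context {R : realType} d (T : measurableType d) (P : probability T R).
Variables (Y : T -> R) (a L : R).
Hypotheses (a0 : 0 < a) (mY : measurable_fun [set: T] Y) (Y0 : forall w, 0 <= Y w).
Hypothesis mgf : (\int[P]_w (expR (a * Y w))%:E <= (expR L)%:E)%E.

Let mE : measurable_fun [set: T] (fun w => (expR (a * Y w))%:E).
Proof. by apply/measurable_EFinP; apply: measurableT_comp => //; exact: measurable_funM. Qed.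

Let L0 : 0 <= L.
Proof.
rewrite -ler_expR expR0 -lee_fin; apply: le_trans mgf.
rewrite -[leLHS](@probability_setT _ _ _ P) -[leLHS]mul1e.
rewrite -integral_cst//; apply: ge0_le_integral => //.
by move=> w _; rewrite lee_fin /= -[leLHS](@expR0 R) ler_expR mulr_ge0// ltW.
Qed.

(** The tangent line of exp at 0 gives a Y + 1 <= exp (a Y - L) + L, and the mean
    of the exponential on the right is at most 1.  Compared with Jensen's inequality
    for the logarithm, this form applies without knowing that Y is
    integrable. *)
Lemma expectation_le_mgf : ('E_P[Y] <= (L / a)%:E)%E.
Proof.
rewrite unlock; set I := (\int[P]_w _)%E.
have I0 : (0 <= I)%E by apply: integral_ge0 => w _; rewrite lee_fin.
suff H : (a%:E * I + 1 <= 1 + L%:E)%E.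
  have aI : (a%:E * I <= L%:E)%E by move: H; rewrite addeC leeD2lE.
  by rewrite mulrC EFinM lee_pdivlMl.
have -> : (a%:E * I + 1 = \int[P]_w ((a * Y w)%:E + 1))%E.
  rewrite ge0_integralD//.
  - have -> : (\int[P]_w 1 = 1)%E by rewrite integral_cst// mul1e; exact: probability_setT.
    congr (_ + _)%E.
    rewrite -ge0_integralZl ?lee_fin ?ltW//; first exact/measurable_EFinP.
    by move=> w _; rewrite lee_fin.
  - by move=> w _; rewrite lee_fin mulr_ge0// ltW.
  - by apply/measurable_EFinP; exact: measurable_funM.
apply: (@le_trans _ _ (\int[P]_w ((expR (- L))%:E * (expR (a * Y w))%:E + L%:E))%E).
  apply: ge0_le_integral => //.
  - by move=> w _; rewrite -EFinD lee_fin addr_ge0// mulr_ge0// ltW.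
  - by apply: emeasurable_funD => //; apply/measurable_EFinP; exact: measurable_funM.
  - by apply: emeasurable_funD => //; exact: measurable_funeM.
  - move=> w _; rewrite -EFinM -!EFinD lee_fin -expRD.
    by have := expR_ge1Dx (- L + a * Y w); lra.
rewrite ge0_integralD//; last exact: measurable_funeM.
rewrite ge0_integralZl ?lee_fin ?expR_ge0//.
have -> : (\int[P]_w L%:E = L%:E)%E.
  by rewrite integral_cst// -[RHS]mule1; congr (_ * _)%E; exact: probability_setT.
rewrite leeD2rE//.
apply: (@le_trans _ _ ((expR (- L))%:E * (expR L)%:E)%E).
  by rewrite lee_wpmul2l ?lee_fin ?expR_ge0.
by rewrite -EFinM -expRD addNr expR0.
Qed.

Lemma tail_le_mgf t : (P [set w | (t < Y w)%R] <= (expR (L - a * t))%:E)%E.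
Proof.
pose X : {RV P >-> R} := mfun_Sub (mem_set mY).
apply: (@le_trans _ _ (P [set w | (t <= X w)%R])).
  apply: le_measure; rewrite ?inE.
  - by have := mY measurableT (measurable_itv `]t, +oo[); rewrite setTI preimage_itvoy.
  - by have := mY measurableT (measurable_itv `[t, +oo[); rewrite setTI preimage_itvcy.
  - by move=> w /= /ltW.
apply: (le_trans (chernoff X t a0)).
rewrite expRD EFinM lee_wpmul2r ?lee_fin ?expR_ge0//.
rewrite /mmt_gen_fun unlock; apply: le_trans mgf; rewrite le_eqVlt; apply/orP; left; apply/eqP.
by apply: eq_integral => w _ /=; rewrite mulrC.
Qed.

End markov_jensen.

Lemma xi_uric_ge0 (R : realType) m n k (M : 'M[R]_(m, n)) : 0 <= xi_uric k M.
Proof.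
rewrite /xi_uric; have [h|h] := pselect (has_sup [set l2norm (M *m x) | x in @S_ric R n k]).
  have [[_ [x xS _]] _] := h; apply: (le_trans (l2norm_ge0 (M *m x))).
  by apply: sup_upper_bound => //=; exists x.
by rewrite sup_out.
Qed.

Lemma rounding_ratio (R : realType) (alpha : R) (m : nat -> nat) :
  (forall n, is_rounding (alpha * n%:R) (m n)) ->
  (fun n => (m n)%:R / n%:R : R) @ \oo --> alpha.
Proof.
move=> ma; apply/cvgrPdist_le => e e0.
near=> n.
have n0 : 0 < n%:R :> R by rewrite ltr0n; near: n; exact: nbhs_infty_gt.
have -> : alpha - (m n)%:R / n%:R = (alpha * n%:R - (m n)%:R) / n%:R.
  by field; rewrite gt_eqF.
rewrite normrM normfV (ger0_norm (ltW n0)) distrC ler_pdivrMr//.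
apply: (le_trans (ltW (ma n))).
rewrite -ler_pdivrMl// mulr1; near: n; exact: nbhs_infty_ger.
Unshelve. all: by end_near. Qed.

Lemma rounding_gt0 (R : realType) (alpha : R) (m : nat -> nat) : 0 < alpha ->
  (forall n, is_rounding (alpha * n%:R) (m n)) -> \forall n \near \oo, (0 < m n)%N.
Proof.
move=> a0 ma; near=> n.
have n0 : 0 < n%:R :> R by rewrite ltr0n; near: n; exact: nbhs_infty_gt.
suff : 0 < (m n)%:R / n%:R :> R by rewrite pmulr_lgt0 ?invr_gt0// ltr0n.
near: n; exact: (cvgr_gt _ (rounding_ratio ma)).
Unshelve. all: by end_near. Qed.

Lemma rounding_le (R : realType) (beta : R) (k : nat -> nat) : beta < 1 ->
  (forall n, is_rounding (beta * n%:R) (k n)) -> \forall n \near \oo, (k n <= n)%N.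
Proof.
move=> b1 kb; near=> n.
have n0 : 0 < n%:R :> R by rewrite ltr0n; near: n; exact: nbhs_infty_gt.
suff : (k n)%:R / n%:R < 1 :> R by rewrite ltr_pdivrMr// mul1r ltr_nat => /ltnW.
near: n; exact: (cvgr_lt _ (rounding_ratio kb)).
Unshelve. all: by end_near. Qed.

(** The infima are approached by concrete parameters. *)
Lemma uric_bound_lt (R : realType) (alpha beta t : R) : 0 < alpha ->
  uric_bound alpha beta < t ->
  exists c g nu, [/\ 0 < c, c / 2 < g, 0 <= nu & rate alpha beta c g nu < t * Num.sqrt alpha].
Proof.
move=> a0; rewrite /uric_bound mulrC ltr_pdivrMr ?sqrtr_gt0// => bt; have [|_ [c /= + <-]] := inf_lt _ bt.
  by exists (- (1 / 2) + I_uric 1 beta + I_sph 1 alpha), 1 => //=; rewrite in_itv/= ltr01.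
rewrite in_itv/= andbT => c0 ct.
have ct' : I_uric c beta < t * Num.sqrt alpha + c / 2 - I_sph c alpha by lra.
have [|_ [g /= + [nu /= + <-]]] := inf_lt _ ct'.
  exists (0 * beta + c + c^-1 * ln (I_uric_fun c c 0)); exists c => /=.
    by rewrite in_itv/=; lra.
  by exists 0; rewrite //= in_itv/= lexx.
rewrite !in_itv/= !andbT => cg nu0 H.
by exists c, g, nu; split => //; rewrite /rate; lra.
Qed.

Section asymptotics.
Context {R : realType} (alpha beta : R).
Hypotheses (beta_gt0 : 0 < beta) (beta_lt_alpha : beta < alpha) (alpha_lt1 : alpha < 1).
Variables (m k : nat -> nat).
Hypothesis m_alpha : forall n : nat, is_rounding (alpha * n%:R) (m n).
Hypothesis k_beta : forall n : nat, is_rounding (beta * n%:R) (k n).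
Variables (d : nat -> measure_display) (T : forall n : nat, measurableType (d n)).
Variables (P : forall n : nat, probability (T n) R).
Variables (A : forall n : nat, 'I_(m n) * 'I_n -> {RV (P n) >-> R}).
Hypothesis A_iid : forall n : nat, iid_std_normal (@A n).
Let xi (n : nat) (w : T n) : R := xi_uric (k n) (\matrix_(i < m n, j < n) @A n (i, j) w).

Let a0 : 0 < alpha. Proof. exact: lt_trans beta_lt_alpha. Qed.

Let dims : \forall n \near \oo, [/\ (0 < m n)%N, (0 < k n)%N & (k n <= n)%N].
Proof.
near=> n; split; near: n.
- exact: rounding_gt0 m_alpha.
- exact: rounding_gt0 k_beta.
- by apply: rounding_le k_beta; exact: lt_trans alpha_lt1.
Unshelve. all: by end_near. Qed.

(** Both conclusions follow from this: L is the exponent of the moment bound,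
    and it is eventually smaller than the value c sqrt n * (t sqrt m) that a
    stretch of t sqrt m contributes, by a margin linear in n. *)
Lemma mgf_eventually t : uric_bound alpha beta < t ->
  exists c D e : R, [/\ 0 < c, 0 < e & \forall n \near \oo, exists L,
    [/\ (\int[P n]_w (expR (c * Num.sqrt n%:R * xi w))%:E <= (expR L)%:E)%E &
        L - c * Num.sqrt n%:R * (t * Num.sqrt (m n)%:R) <= D - e * n%:R]].
Proof.
move=> /(uric_bound_lt a0)[c [g [nu [c0 cg nu0]]]]; set r := rate _ _ _ _ _ => rt.
(* Half of the gap is given up to the convergence of m n / n to alpha. *)
pose e := (t * Num.sqrt alpha - r) / 2.
have e0 : 0 < e by rewrite /e; lra.
exists c, (offset alpha c nu), (c * e); split => //; first exact: mulr_gt0.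
have cv : (fun n => t * Num.sqrt ((m n)%:R / n%:R)) @ \oo --> t * Num.sqrt alpha.
  apply: cvgM; first exact: cvg_cst.
  by apply: continuous_cvg (rounding_ratio m_alpha); exact: sqrt_continuous.
near=> n.
have [m0 k0 kn] : [/\ (0 < m n)%N, (0 < k n)%N & (k n <= n)%N] by near: n.
have n0 : 0 < n%:R :> R by rewrite ltr0n (leq_trans k0).
exists (n%:R * (c * r) + offset alpha c nu); split.
  exact: (xi_mgf_rate a0 m0 k0 kn (m_alpha n) (k_beta n) (A_iid n) c0 cg nu0).
have H : r + e < t * Num.sqrt ((m n)%:R / n%:R).
  by near: n; apply: (cvgr_gt _ cv); rewrite /e; lra.
have -> : Num.sqrt (m n)%:R = Num.sqrt ((m n)%:R / n%:R) * Num.sqrt n%:R :> R.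
  by rewrite -sqrtrM ?divr_ge0// divfK// gt_eqF.
have sE : Num.sqrt n%:R * Num.sqrt n%:R = n%:R :> R by rewrite -expr2 sqr_sqrtr// ltW.
have -> : c * Num.sqrt n%:R * (t * (Num.sqrt ((m n)%:R / n%:R) * Num.sqrt n%:R)) =
   n%:R * (c * (t * Num.sqrt ((m n)%:R / n%:R))) by rewrite -[X in X * (c * _)]sE; set q := Num.sqrt (_ / _); set s := Num.sqrt _; ring.
have : n%:R * (c * (r + e)) <= n%:R * (c * (t * Num.sqrt ((m n)%:R / n%:R))).
  by rewrite ler_pM2l// ler_pM2l// ltW.
lra.
Unshelve. all: by end_near. Qed.

Let mxi : \forall n \near \oo, measurable_fun [set: T n] (@xi n).
Proof.
by apply: filterS dims => n [m0 k0 kn]; exact: (measurable_xi m0 k0 kn).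
Qed.

Lemma expectation_eventually t : uric_bound alpha beta < t ->
  \forall n \near \oo, ('E_(P n)[@xi n] * ((Num.sqrt (m n)%:R)^-1)%:E <= t%:E)%E.
Proof.
move=> /mgf_eventually[c [D [e [c0 e0 H]]]]; near=> n.
have [m0 k0 kn] : [/\ (0 < m n)%N, (0 < k n)%N & (k n <= n)%N] by near: n.
have [L [mgf LD]] : exists L,
    [/\ (\int[P n]_w (expR (c * Num.sqrt n%:R * xi w))%:E <= (expR L)%:E)%E &
        L - c * Num.sqrt n%:R * (t * Num.sqrt (m n)%:R) <= D - e * n%:R] by near: n.
have sm : 0 < Num.sqrt (m n)%:R :> R by rewrite sqrtr_gt0 ltr0n.
have cn : 0 < c * Num.sqrt n%:R by rewrite mulr_gt0// sqrtr_gt0 ltr0n (leq_trans k0).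
have mx : measurable_fun [set: T n] (@xi n) by near: n.
have := expectation_le_mgf cn mx (fun w => xi_uric_ge0 _ _) mgf.
rewrite lee_pdivrMr// -EFinM => /le_trans; apply; rewrite lee_fin ler_pdivrMr//.
have : D <= e * n%:R by rewrite -ler_pdivrMl//; near: n; exact: nbhs_infty_ger.
lra.
Unshelve. all: by end_near. Qed.

Lemma probability_to1 t : uric_bound alpha beta < t ->
  (fun n => P n [set w | xi w <= t * Num.sqrt (m n)%:R]) @ \oo --> 1%E.
Proof.
move=> /mgf_eventually[c [D [e [c0 e0 H]]]].
have lo : (fun n => (1 - expR (D - e * n%:R))%:E) @ \oo --> 1%E.
  apply: cvg_EFin; first exact: nearW.
  rewrite -[X in _ --> X]subr0; apply: cvgB; first exact: cvg_cst.
  rewrite [X in X @ _ --> _](_ : _ = fun n : nat => expR D * expR (- e) ^+ n); last first.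
    by apply/funext => n; rewrite expRD -expRM_natl mulrN [n%:R * _]mulrC.
  rewrite -[X in _ --> X](mulr0 (expR D)); apply: cvgM; first exact: cvg_cst.
  by apply: cvg_expr; rewrite ger0_norm ?expR_ge0// -[ltRHS]expR0 ltr_expR; lra.
apply: (squeeze_cvge _ lo (cvg_cst 1%E)); near=> n.
have [m0 k0 kn] : [/\ (0 < m n)%N, (0 < k n)%N & (k n <= n)%N] by near: n.
have [L [mgf LD]] : exists L,
    [/\ (\int[P n]_w (expR (c * Num.sqrt n%:R * xi w))%:E <= (expR L)%:E)%E &
        L - c * Num.sqrt n%:R * (t * Num.sqrt (m n)%:R) <= D - e * n%:R] by near: n.
have cn : 0 < c * Num.sqrt n%:R by rewrite mulr_gt0// sqrtr_gt0 ltr0n (leq_trans k0).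
have mx : measurable_fun [set: T n] (@xi n) by near: n.
have tail := tail_le_mgf cn mx mgf (t * Num.sqrt (m n)%:R).
have mA : measurable [set w | t * Num.sqrt (m n)%:R < @xi n w].
  by have := mx measurableT _ (measurable_itv `]t * Num.sqrt (m n)%:R, +oo[); rewrite setTI preimage_itvoy.
have -> : [set w | @xi n w <= t * Num.sqrt (m n)%:R] = ~` [set w | t * Num.sqrt (m n)%:R < @xi n w].
  by apply/seteqP; split => w /=; [move=> ?; apply/negP; rewrite -leNgt|move=> /negP; rewrite -leNgt].
apply/andP; split; last by apply: probability_le1; exact: measurableC.
rewrite probability_setC// EFinB leeB//=.
by apply: (le_trans tail); rewrite lee_fin ler_expR.
Unshelve. all: by end_near. Qed.

Lemma limn_esup_expectation :
  (limn_esup (fun n : nat => 'E_(P n)[@xi n] * ((Num.sqrt (m n)%:R)^-1)%:E) <=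
   (uric_bound alpha beta)%:E)%E.
Proof.
apply/lee_addgt0Pr => e e0; rewrite -EFinD.
have /expectation_eventually H : uric_bound alpha beta < uric_bound alpha beta + e by lra.
rewrite /limn_esup limf_esupE.
apply: ereal_inf_le; exists (ereal_sup ((fun n => 'E_(P n)[@xi n] * ((Num.sqrt (m n)%:R)^-1)%:E)%E @` 
   [set n | ('E_(P n)[@xi n] * ((Num.sqrt (m n)%:R)^-1)%:E <= (uric_bound alpha beta + e)%:E)%E])).
  by exists [set n | ('E_(P n)[@xi n] * ((Num.sqrt (m n)%:R)^-1)%:E <= (uric_bound alpha beta + e)%:E)%E].
by apply: ge_ereal_sup => _ [n /= nH <-].
Qed.

(** Being at least the limit superior of nonnegative means. *)
Lemma uric_bound_ge0 : 0 <= uric_bound alpha beta.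
Proof.
rewrite -lee_fin; apply: le_trans limn_esup_expectation.
apply: limf_esup_ge0 => [|n]; first exact: filter_not_empty.
rewrite mule_ge0//.
by rewrite unlock; apply: integral_ge0 => w _; rewrite lee_fin; exact: xi_uric_ge0.
Qed.

(** Both sides are nonnegative, so they may be squared. *)
Lemma sqr_event t n : uric_bound alpha beta < t ->
  [set w | @xi n w ^+ 2 <= t ^+ 2 * (m n)%:R] = [set w | @xi n w <= t * Num.sqrt (m n)%:R].
Proof.
move=> bt; have t0 : 0 <= t by apply: le_trans uric_bound_ge0 _; exact: ltW.
have -> : t ^+ 2 * (m n)%:R = (t * Num.sqrt (m n)%:R) ^+ 2 by rewrite exprMn sqr_sqrtr.
by apply/seteqP; split => w /=; rewrite ler_sqr ?nnegrE ?mulr_ge0 ?sqrtr_ge0 ?xi_uric_ge0.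
Qed.

End asymptotics.

Theorem theorem1 (R : realType) (alpha beta : R)
  (beta_gt0 : 0 < beta) (beta_lt_alpha : beta < alpha) (alpha_lt1 : alpha < 1)
  (m k : nat -> nat)
  (m_alpha : forall n : nat, is_rounding (alpha * n%:R) (m n))
  (k_beta : forall n : nat, is_rounding (beta * n%:R) (k n))
  (d : nat -> measure_display) (T : forall n : nat, measurableType (d n))
  (P : forall n : nat, probability (T n) R)
  (A : forall n : nat, 'I_(m n) * 'I_n -> {RV (P n) >-> R})
  (A_iid : forall n : nat, iid_std_normal (A n)) :
  let xi := fun (n : nat) (w : T n) =>
    xi_uric (k n) (\matrix_(i < m n, j < n) A n (i, j) w) in
  (limn_esup (fun n : nat =>
      'E_(P n)[xi n] * ((Num.sqrt (m n)%:R)^-1)%:E) <=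
    (uric_bound alpha beta)%:E)%E
  /\
  (forall xi_low : R, uric_bound alpha beta < xi_low ->
    ((fun n : nat => P n [set w | xi n w <= xi_low * Num.sqrt (m n)%:R])
       @ \oo --> 1%E)
    /\
    ((fun n : nat => P n [set w | xi n w ^+ 2 <= xi_low ^+ 2 * (m n)%:R])
       @ \oo --> 1%E)).
Proof.
move=> xi; split.
  exact: (limn_esup_expectation beta_gt0 beta_lt_alpha alpha_lt1 m_alpha k_beta A_iid).
move=> t bt.
have H := probability_to1 beta_gt0 beta_lt_alpha alpha_lt1 m_alpha k_beta A_iid bt.
split; first exact: H.
rewrite [X in X @ _ --> _](_ : _ = fun n => P n [set w | xi n w <= t * Num.sqrt (m n)%:R])//.
apply/funext => n; congr (P n _).
exact: (sqr_event beta_gt0 beta_lt_alpha alpha_lt1 m_alpha k_beta A_iid n bt).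
Qed.
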